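(* For every $n\ge1$, the map $\Theta=c\circ r\circ\theta\circ c\circ r$ (defined in the context) is a bijection from $S_n(312)$ to $S_n(312)$ satisfying $\mathrm{bast}(\pi)=\mathrm{foze}(\Theta(\pi))$ for all $\pi\in S_n(312)$.
   Context: $S_n$ is the set of permutations of $[n]=\{1,\dots,n\}$ in one-line notation; $S_n(\sigma)$ is the set of those avoiding the classical pattern $\sigma$ (no subsequence whose relative order is that of $\sigma$). Reverse: $r(\pi)=\pi_n\pi_{n-1}\cdots\pi_1$. Complement: $c(\pi)=(n+1-\pi_1)\cdots(n+1-\pi_n)$. Direct sum: for $\alpha\in S_a,\beta\in S_b$, $\alpha\oplus\beta\in S_{a+b}$ has entries $\alpha_i$ for $i\le a$ and $\beta_{i-a}+a$ for $i>a$. Let $\mathrm{Av}'_n(231)$ be the set of $231$-avoiding $\pi\in S_n$ with $\pi_1=n$. Inverse descent runs: for $\tau\in S_n$ a descent run is a maximal set of consecutive positions $\{i,\dots,j\}$ with $\tau_i>\dots>\tau_j$; an inverse descent run of $\pi$ is a set $I\subseteq[n]$ with $\{\pi_i:i\in I\}$ a descent run of $\pi^{-1}$; they partition $[n]$ and are indexed $I_1,\dots,I_k$ with $\max(I_1)>\dots>\max(I_k)$. Stack procedure on input $(c_1,\dots,c_k)$ with $n=\sum c_i$ and a set $M$: start with empty stacks $\mathscr{A},\mathscr{B}$ and $p:=n$; for $i=1,\dots,k$: (1) repeat $c_i$ times: push $p$ onto $\mathscr{A}$ and decrease $p$ by 1; (2) while $\mathscr{A}$ is nonempty and its top is not in $M$,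 pop it and push onto $\mathscr{B}$; (3) if $\mathscr{A}$ is nonempty, pop its top and push onto $\mathscr{B}$; output the word read from the top to the bottom of $\mathscr{B}$. For $\pi\in\mathrm{Av}'_n(231)$ with inverse descent runs $I_1,\dots,I_k$, define $\theta'(\pi)$ as the output of the stack procedure with $c_i=|I_i|$ and $M$ equal to the set of ascents $\{i<n:\pi_i<\pi_{i+1}\}$ of $\pi$ (which has $k-1$ elements). For $231$-avoiding $\pi\in S_n$, write uniquely $\pi=\pi^{(1)}\oplus\cdots\oplus\pi^{(t)}$ with each $\pi^{(j)}$ a $231$-avoiding permutation beginning with its largest entry, and set $\theta(\pi)=\theta'(\pi^{(1)})\oplus\cdots\oplus\theta'(\pi^{(t)})$. Vincular pattern counts for $\pi\in S_n$ (where $j$ ranges over positions with $j>i+1$, resp. $j<i$): $\underline{13}2(\pi)=\#\{(i,j):j>i+1,\ \pi_i<\pi_j<\pi_{i+1}\}$; $\underline{21}3(\pi)=\#\{(i,j):j>i+1,\ \pi_{i+1}<\pi_i<\pi_j\}$; $\underline{32}1(\pi)=\#\{(i,j):j>i+1,\ \pi_j<\pi_{i+1}<\pi_i\}$; $3\underline{21}(\pi)=\#\{(j,i):j<i<n,\ \pi_{i+1}<\pi_i<\pi_j\}$; $\mathrm{des}(\pi)=\#\{i<n:\pi_i>\pi_{i+1}\}$. Then $\mathrm{bast}=\underline{13}2+\underline{21}3+\underline{32}1+\mathrm{des}$ and $\mathrm{foze}=\underline{21}3+3\underline{21}+\underline{13}2+\mathrm{des}$. *)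

(* Defs.v *)
From mathcomp Require Import all_boot.
From mathcomp Require Import classical_sets functions.

Set Implicit Arguments.
Unset Strict Implicit.
Unset Printing Implicit Defensive.

(* Permutations are words over nat in one-line notation, with entries in      *)
(* {1, ..., n}.  Positions are 1-based; pi_i is [entry pi i] (1 <= i <= n).   *)

Definition is_perm (n : nat) (pi : seq nat) : bool := perm_eq pi (iota 1 n).

Definition entry (pi : seq nat) (i : nat) : nat := nth 0 pi i.-1.

Definition order_iso (s t : seq nat) : bool :=
  (size s == size t) &&
  all (fun i => all (fun j => (entry s i < entry s j) == (entry t i < entry t j))
                    (iota 1 (size s)))
      (iota 1 (size s)).

Definition avoids (sigma pi : seq nat) : Prop :=
  forall s : seq nat, subseq s pi -> ~~ order_iso s sigma.

Definition Sn_av (n : nat) (sigma : seq nat) : set (seq nat) :=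
  [set pi | is_perm n pi /\ avoids sigma pi]%classic.

(* Intended for 0 < n: the empty word satisfies the condition for n = 0. *)
Definition Av'231 (n : nat) : set (seq nat) :=
  [set pi | Sn_av n [:: 2; 3; 1] pi /\ entry pi 1 = n]%classic.


Definition complement (pi : seq nat) : seq nat :=
  [seq (size pi).+1 - x | x <- pi].

Definition inverse (pi : seq nat) : seq nat :=
  [seq (index v pi).+1 | v <- iota 1 (size pi)].

Definition dsum (a b : seq nat) : seq nat := a ++ [seq x + size a | x <- b].

Definition dsums (ps : seq (seq nat)) : seq nat := foldr dsum [::] ps.

Definition ascents (pi : seq nat) : seq nat :=
  [seq i <- iota 1 (size pi).-1 | entry pi i < entry pi i.+1].

(* Non-empty intervals {i, ..., j} of positions, coded by the pair (i, j).    *)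
Definition intervals (n : nat) : seq (nat * nat) :=
  [seq ij <- [seq (i, j) | i <- iota 1 n, j <- iota 1 n] | ij.1 <= ij.2].

Definition positions (ij : nat * nat) : seq nat := iota ij.1 (ij.2 - ij.1).+1.

Definition decreasing_on (tau : seq nat) (ij : nat * nat) : bool :=
  sorted gtn [seq entry tau p | p <- positions ij].

Definition is_descent_run (tau : seq nat) (ij : nat * nat) : bool :=
  decreasing_on tau ij &&
  all (fun kl => [&& decreasing_on tau kl, kl.1 <= ij.1 & ij.2 <= kl.2]
                   ==> (kl == ij))
      (intervals (size tau)).

Definition descent_runs (tau : seq nat) : seq (seq nat) :=
  [seq positions ij | ij <- intervals (size tau) & is_descent_run tau ij].

Definition smax (D : seq nat) : nat := foldr maxn 0 D.

(* {pi_i : i in D} = R means D = {(pi^-1)_v : v in R}. *)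
Definition inv_descent_runs (pi : seq nat) : seq (seq nat) :=
  let tau := inverse pi in
  sort (fun D E => smax E <= smax D)
       [seq [seq entry tau v | v <- R] | R <- descent_runs tau].

(* Stacks are lists whose head is the top. *)

Fixpoint push_down (c : nat) (A : seq nat) (p : nat) : seq nat * nat :=
  if c is c'.+1 then push_down c' (p :: A) p.-1 else (A, p).

Fixpoint pop_while (M A B : seq nat) : seq nat * seq nat :=
  if A is a :: A' then
    if a \in M then (A, B) else pop_while M A' (a :: B)
  else (A, B).

Definition pop_one (A B : seq nat) : seq nat * seq nat :=
  if A is a :: A' then (A', a :: B) else (A, B).

Fixpoint stack_loop (cs M A B : seq nat) (p : nat) : seq nat :=
  if cs is c :: cs' then
    let: (A1, p1) := push_down c A p in
    let: (A2, B2) := pop_while M A1 B in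
    let: (A3, B3) := pop_one A2 B2 in
    stack_loop cs' M A3 B3 p1
  else B.

Definition stack_procedure (cs M : seq nat) : seq nat :=
  stack_loop cs M [::] [::] (sumn cs).

Definition theta' (pi : seq nat) : seq nat :=
  stack_procedure [seq size D | D <- inv_descent_runs pi] (ascents pi).

(* In a direct sum of permutations each beginning with its largest entry, the *)
(* first entry m of the sum is the length of its first summand.  Lemma        *)
(* [blocksP] below shows that [blocks] computes the unique such decomposition *)
(* of a 231-avoiding permutation.  The argument k is fuel.                    *)
Fixpoint blocks_rec (k : nat) (pi : seq nat) : seq (seq nat) :=
  match k, pi with
  | k'.+1, m :: _ => take m pi :: blocks_rec k' [seq x - m | x <- drop m pi]
  | _, _ => [::]
  end.

Definition blocks (pi : seq nat) : seq (seq nat) := blocks_rec (size pi) pi.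

Definition block_decomposition (pi : seq nat) (bs : seq (seq nat)) : Prop :=
  dsums bs = pi /\
  (forall b, b \in bs -> 0 < size b /\ Av'231 (size b) b).

Lemma blocks_rec_dsums (bs : seq (seq nat)) (k : nat) :
  (forall b, b \in bs -> 0 < size b /\ entry b 1 = size b) ->
  size (dsums bs) <= k -> blocks_rec k (dsums bs) = bs.
Proof.
elim: bs k => [|b bs IH] k Hb; first by case: k.
have [] := Hb b (mem_head _ _); case: b Hb => [//|m b'] Hb _; rewrite /entry [nth _ _ _]/= => Em.
case: k => [//|k]; rewrite [dsums _]/= /dsum.
rewrite size_cat size_map addSn ltnS => Hk.
rewrite [LHS]/= -/(_ ++ _) -[m :: _ ++ _]/((m :: b') ++ _).
rewrite {1}Em take_size_cat // {1}Em drop_size_cat //; congr (_ :: _); first by rewrite -Em.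
rewrite -map_comp (@eq_map _ _ _ id) => [|x /=]; last by rewrite Em addnK.
rewrite map_id; apply: IH => [b Hin|]; last exact: leq_trans (leq_addl _ _) Hk.
by apply: Hb; rewrite inE Hin orbT.
Qed.

Lemma cat_filter_threshold (m : nat) (w : seq nat) :
  (forall x y, subseq [:: x; y] w -> m < x -> m < y) ->
  w = [seq x <- w | x <= m] ++ [seq x <- w | m < x].
Proof.
elim: w => [//|a w IH] H /=.
have Hw : w = [seq x <- w | x <= m] ++ [seq x <- w | m < x].
  by apply: IH => x y Hs; apply: H; apply: subseq_trans Hs (subseq_cons _ _).
case: (leqP a m) => Ham; first by rewrite /= -Hw.
have Hall : all (fun y => m < y) w.
  apply/allP => y yw; apply: (H a y) => //.
  by rewrite /= eqxx sub1seq.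
have -> : [seq x <- w | x <= m] = [::].
  apply/eqP; rewrite -(negbK (_ == _)) -has_filter -all_predC.
  by apply: sub_all Hall => y /=; rewrite ltnNge.
by rewrite (all_filterP Hall).
Qed.

Lemma order_iso_231 (a b c : nat) :
  c < a -> a < b -> order_iso [:: a; b; c] [:: 2; 3; 1].
Proof.
move=> ca ab; have cb := ltn_trans ca ab.
have asym x y : x < y -> (y < x) = false by move=> xy; rewrite ltnNge (ltnW xy).
by rewrite /order_iso /= /entry /= !ltnn ab ca cb (asym _ _ ab) (asym _ _ ca) (asym _ _ cb).
Qed.

Lemma order_iso_shift (m : nat) (s t : seq nat) :
  order_iso [seq x + m | x <- s] t = order_iso s t.
Proof.
rewrite /order_iso size_map; congr (_ && _).
apply: eq_in_all => i; rewrite mem_iota => /andP[i1 i2].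
apply: eq_in_all => j; rewrite mem_iota => /andP[j1 j2].
by rewrite /entry !(nth_map 0) ?ltn_add2r // prednK // -ltnS.
Qed.

Lemma blocks_rec_correct (k n : nat) (pi : seq nat) :
  n <= k -> Sn_av n [:: 2; 3; 1] pi -> block_decomposition pi (blocks_rec k pi).
Proof.
elim: k n pi => [|k IH] n [|m w] Hn [Hp Hav] //.
  by case: n Hn Hp Hav => // _ /perm_size.
set pi := m :: w in Hp Hav *.
have Sz : size pi = n by rewrite (perm_size Hp) size_iota.
have Hm : m \in iota 1 n by rewrite -(perm_mem Hp) mem_head.
move: Hm; rewrite mem_iota add1n ltnS => /andP[m1 mn].
have Un : uniq pi by rewrite (perm_uniq Hp) iota_uniq.
have Epi : pi = [seq x <- pi | x <= m] ++ [seq x <- pi | m < x].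
  apply: cat_filter_threshold => x y Hs mx.
  rewrite ltnNge; apply/negP => ym.
  have Hxy : subseq [:: x; y] w.
    move: Hs; rewrite /pi /=; case: eqP => // xm; by rewrite xm ltnn in mx.
  have ym' : y < m.
    rewrite ltn_neqAle ym andbT; apply/eqP => ym'.
    have : y \in w by apply: (mem_subseq Hxy); rewrite !inE eqxx orbT.
    by rewrite ym'; apply/negP; case/andP: Un.
  have Hs3 : subseq [:: m; x; y] pi by rewrite /pi /= eqxx.
  by have := Hav _ Hs3; rewrite order_iso_231.
have Ei : iota 1 n = iota 1 m ++ iota m.+1 (n - m).
  by rewrite -{1}(subnKC mn) iotaD add1n.
have Plo : perm_eq [seq x <- pi | x <= m] (iota 1 m).
  rewrite (permPl (perm_filter _ Hp)) Ei filter_cat.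
  have /all_filterP-> : all (fun x => x <= m) (iota 1 m).
    by apply/allP => x; rewrite mem_iota add1n ltnS => /andP[].
  have -> : [seq x <- iota m.+1 (n - m) | x <= m] = [::].
    apply/eqP; rewrite -(negbK (_ == _)) -has_filter -all_predC.
    by apply/allP => x; rewrite mem_iota /= -ltnNge => /andP[].
  by rewrite cats0.
have Phi : perm_eq [seq x <- pi | m < x] (iota m.+1 (n - m)).
  rewrite (permPl (perm_filter _ Hp)) Ei filter_cat.
  have -> : [seq x <- iota 1 m | m < x] = [::].
    apply/eqP; rewrite -(negbK (_ == _)) -has_filter -all_predC.
    by apply/allP => x; rewrite mem_iota /= -leqNgt add1n ltnS => /andP[].
  have /all_filterP-> : all (fun x => m < x) (iota m.+1 (n - m)).
    by apply/allP => x; rewrite mem_iota => /andP[].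
  by [].
have Slo : size [seq x <- pi | x <= m] = m by rewrite (perm_size Plo) size_iota.
have Etake : take m pi = [seq x <- pi | x <= m].
  by rewrite {1}Epi take_size_cat.
have Edrop : drop m pi = [seq x <- pi | m < x].
  by rewrite {1}Epi drop_size_cat.
set pi' := [seq x - m | x <- drop m pi].
have Epi' : [seq x + m | x <- pi'] = drop m pi.
  rewrite /pi' -map_comp -[RHS]map_id; apply/eq_in_map => x.
  by rewrite Edrop mem_filter => /andP[/ltnW ? _] /=; rewrite subnK.
have Hpi' : Sn_av (n - m) [:: 2; 3; 1] pi'.
  split.
    rewrite /is_perm /pi' Edrop (permPl (perm_map _ Phi)) -addn1 iotaDl -map_comp.
    by rewrite (@eq_map _ _ _ id) ?map_id // => x /=; rewrite addKn.
  move=> s Hs; rewrite -(order_iso_shift m); apply: Hav.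
  apply: subseq_trans (map_subseq _ Hs) _.
  by rewrite Epi'; apply: drop_subseq.
have [|E1 E2] := IH (n - m) pi' _ Hpi'.
  by rewrite leq_subLR; apply: leq_trans Hn _; rewrite -addn1 addnC leq_add2r.
have -> : blocks_rec k.+1 pi = take m pi :: blocks_rec k pi' by [].
have St : size (take m pi) = m by rewrite Etake.
split.
  by rewrite /dsums /= -/(dsums _) E1 /dsum St Epi' cat_take_drop.
move=> b; rewrite inE => /orP[/eqP->|]; last exact: E2.
rewrite St; split=> //; split; first split.
- by rewrite /is_perm Etake.
- by move=> s Hs; apply: Hav; apply: subseq_trans Hs (take_subseq _ _).
- by rewrite /entry nth_take.
Qed.

Lemma blocksP (n : nat) (pi : seq nat) (bs : seq (seq nat)) :
  Sn_av n [:: 2; 3; 1] pi -> block_decomposition pi bs <-> bs = blocks pi.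
Proof.
move=> Hpi; split=> [[<- Hb]|->].
  by rewrite /blocks blocks_rec_dsums // => b /Hb[? [_ ?]].
apply: (@blocks_rec_correct _ n) => //.
by case: Hpi => /perm_size->; rewrite size_iota.
Qed.

Definition theta (pi : seq nat) : seq nat := dsums [seq theta' b | b <- blocks pi].

Definition Theta (pi : seq nat) : seq nat :=
  complement (rev (theta (complement (rev pi)))).

(* Number of pairs (i, j) of positions of pi satisfying P. *)
Definition count_pairs (pi : seq nat) (P : nat -> nat -> bool) : nat :=
  count (fun ij => P ij.1 ij.2)
        [seq (i, j) | i <- iota 1 (size pi), j <- iota 1 (size pi)].

(* In a pattern name, underlined (adjacent) letters of a vincular pattern are preceded by u. *)
Definition pat_u13_2 (pi : seq nat) : nat :=
  count_pairs pi (fun i j =>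
    [&& i.+1 < j, entry pi i < entry pi j & entry pi j < entry pi i.+1]).

Definition pat_u21_3 (pi : seq nat) : nat :=
  count_pairs pi (fun i j =>
    [&& i.+1 < j, entry pi i.+1 < entry pi i & entry pi i < entry pi j]).

Definition pat_u32_1 (pi : seq nat) : nat :=
  count_pairs pi (fun i j =>
    [&& i.+1 < j, entry pi j < entry pi i.+1 & entry pi i.+1 < entry pi i]).

Definition pat_3_u21 (pi : seq nat) : nat :=
  count_pairs pi (fun j i =>
    [&& j < i, i < size pi, entry pi i.+1 < entry pi i & entry pi i < entry pi j]).

Definition des (pi : seq nat) : nat :=
  count (fun i => entry pi i.+1 < entry pi i) (iota 1 (size pi).-1).

Definition bast (pi : seq nat) : nat :=
  pat_u13_2 pi + pat_u21_3 pi + pat_u32_1 pi + des pi.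

Definition foze (pi : seq nat) : nat :=
  pat_u21_3 pi + pat_3_u21 pi + pat_u13_2 pi + des pi.

(* Main.v *)
Require Import Defs.
From mathcomp Require Import all_boot.
From mathcomp Require Import classical_sets functions boolp.
From mathcomp Require Import zify.

(* Let pi avoid 312, sigma = c(r(pi)), which avoids 231, and tau = theta(sigma), so that
   Theta(pi) = c(r(tau)).

   Statistics.  If a word avoids 312 and has a descent at i, every j > i + 1 completes it to an
   occurrence of 21-3 or of 32-1 (21 and 32 being adjacent); so there are n - 1 - i of these.  In any
   permutation the occurrences of 21-3 and 3-21 over a descent at i number n - pi_i.  Finally a
   312-avoider has n - pi_1 - asc(pi) occurrences of 13-2.  Hence bast(pi) = foze(Theta(pi)) as soon
   as the descent positions of sigma are the descent bottoms of tau, and sigma and tau have the same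
   last letter.  The former holds because a letter popped in the stack procedure is followed by a
   smaller one exactly when it lies in M, the latter because the first letter popped is n + 1 - c_1.

   Bijectivity.  The output of the stack procedure determines M and the c_i.  A 231-avoider is coded
   by a binary tree, hence by a Dyck word, whose up and down runs are the descent run lengths and the
   reversed sequence of the c_i; so (c, M) determines the permutation.  The same tree shows that the
   procedure never runs out of elements of M.  An injection of a finite set into itself is onto. *)
Set Implicit Arguments.
Unset Strict Implicit.
Unset Printing Implicit Defensive.


(** * Patterns *)

Definition free231 (w : seq nat) : Prop :=
  forall a b c : nat, subseq [:: a; b; c] w -> ~~ ((c < a) && (a < b)).

Definition free312 (w : seq nat) : Prop :=
  forall a b c : nat, subseq [:: a; b; c] w -> ~~ ((b < c) && (c < a)).

Lemma avoids231P w : avoids [:: 2; 3; 1] w <-> free231 w.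
Proof.
split=> H.
  move=> a b c /H; apply: contra => /andP[ca ab]; exact: order_iso_231.
move=> s sw; apply/negP; case: s sw => [|a [|b [|c [|d s]]]] sw //=.
have := H _ _ _ sw; rewrite /order_iso /= /entry /=; lia.
Qed.

Lemma avoids312P w : avoids [:: 3; 1; 2] w <-> free312 w.
Proof.
split=> H.
  move=> a b c /H; apply: contra => /andP[ca ab].
  rewrite /order_iso /= /entry /=; lia.
move=> s sw; apply/negP; case: s sw => [|a [|b [|c [|d s]]]] sw //=.
have := H _ _ _ sw; rewrite /order_iso /= /entry /=; lia.
Qed.

Lemma subseq_nth_cons (w s : seq nat) i :
  i < size w -> subseq s (drop i.+1 w) -> subseq (nth 0 w i :: s) w.
Proof.
move=> iw sw; apply: (subseq_trans _ (drop_subseq w i)).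
by rewrite (drop_nth 0) //= eqxx.
Qed.

Lemma subseq_nth3 (w : seq nat) i j k :
  i < j -> j < k -> k < size w ->
  subseq [:: nth 0 w i; nth 0 w j; nth 0 w k] w.
Proof.
move=> ij jk kn; have jn := ltn_trans jk kn.
have Ej : nth 0 w j = nth 0 (drop i.+1 w) (j - i.+1) by rewrite nth_drop subnKC.
apply: subseq_nth_cons; first exact: ltn_trans ij jn.
rewrite Ej; apply: subseq_nth_cons; first by rewrite size_drop; lia.
rewrite drop_drop sub1seq.
have -> : (j - i.+1).+1 + i.+1 = j.+1 by lia.
have -> : nth 0 w k = nth 0 (drop j.+1 w) (k - j.+1) by rewrite nth_drop subnKC.
by apply: mem_nth; rewrite size_drop ltn_sub2r // (leq_ltn_trans _ kn).
Qed.

Lemma subseq_index3 (w : seq nat) (x y z : nat) :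
  index x w < index y w -> index y w < index z w -> z \in w ->
  subseq [:: x; y; z] w.
Proof.
move=> xy yz zw; have zn : index z w < size w by rewrite index_mem.
have yw : y \in w by rewrite -index_mem (ltn_trans yz).
have xw : x \in w by rewrite -index_mem (ltn_trans xy) ?index_mem.
by have := subseq_nth3 xy yz zn; rewrite !nth_index.
Qed.

Lemma subseq2_cat_le m (s t : seq nat) (x y : nat) :
  all (fun v => v <= m) s -> all (fun v => m < v) t ->
  subseq [:: x; y] (s ++ t) -> m < x -> m < y.
Proof.
move=> + Ht; elim: s => [_|z s IH /= /andP[zm sm]].
  by move=> /mem_subseq H _; apply: (allP Ht); apply: H; rewrite !inE eqxx orbT.
case: eqP => [->|_]; [lia | exact: IH].
Qed.

(** Let [c < a < b] be an occurrence. If [c <= m], then [b <= m] too, because only large letters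
    follow a large one, so it lies in [s]; otherwise all three letters exceed [m] and it lies in
    [t]. *)
Lemma free231_cat m (s t : seq nat) :
  all (fun v => v <= m) s -> all (fun v => m < v) t ->
  free231 s -> free231 t -> free231 (s ++ t).
Proof.
move=> Hs Ht Fs Ft a b c H; apply/negP => /andP[ca ab].
have H2 x y := subseq2_cat_le (x := x) (y := y) Hs Ht.
have Hbc : m < b -> m < c.
  by apply: H2; apply: (subseq_trans _ H); exact: subseq_cons.
have filt (p : pred nat) x y z : p x -> p y -> p z -> subseq [:: x; y; z] (s ++ t) ->
    subseq [:: x; y; z] (filter p s ++ filter p t).
  by move=> px py pz xyz; rewrite -filter_cat subseq_filter /= px py pz.
have [cm|mc] := leqP c m.
  have bm : b <= m by rewrite leqNgt; apply/negP => /Hbc; lia.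
  have := filt (fun v => v <= m) a b c.
  have -> : [seq v <- t | v <= m] = [::].
    apply/eqP; rewrite -(negbK (_ == _)) -has_filter -all_predC.
    by apply: sub_all Ht => y /=; rewrite ltnNge.
  rewrite (all_filterP Hs) cats0.
  by move=> /(_ ltac:(lia) bm cm H)/Fs; rewrite ca ab.
have := filt (fun v => m < v) a b c.
have -> : [seq v <- s | m < v] = [::].
  apply/eqP; rewrite -(negbK (_ == _)) -has_filter -all_predC.
  by apply: sub_all Hs => y /=; rewrite leqNgt.
rewrite (all_filterP Ht) cat0s.
by move=> /(_ ltac:(lia) ltac:(lia) mc H)/Ft; rewrite ca ab.
Qed.

Lemma free231_sub s w : subseq s w -> free231 w -> free231 s.
Proof. by move=> sw H a b c abc; apply: H (subseq_trans abc sw). Qed.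

Lemma free231_shift m w : free231 w -> free231 [seq x + m | x <- w].
Proof.
move=> H a b c abc; have := map_subseq (fun x => x - m) abc.
have -> : [seq x - m | x <- [seq x + m | x <- w]] = w.
  by rewrite -map_comp -[RHS]map_id; apply: eq_map => x /=; rewrite addnK.
move=> /H/=; have/mapP [x _ ->] : c \in [seq x + m | x <- w].
  by apply: (mem_subseq abc); rewrite !inE eqxx !orbT.
lia.
Qed.

(** * Permutations *)

Lemma perm_size1 n w : is_perm n w -> size w = n.
Proof. by move/perm_size->; rewrite size_iota. Qed.

Lemma perm_uniq1 n w : is_perm n w -> uniq w.
Proof. by move/perm_uniq->; rewrite iota_uniq. Qed.

Lemma perm_mem1 n w x : is_perm n w -> (x \in w) = (0 < x <= n).
Proof. by move/perm_mem->; rewrite mem_iota; lia. Qed.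

Lemma perm_bound n w : is_perm n w -> all (fun v => v <= n) w.
Proof. by move=> H; apply/allP => x; rewrite (perm_mem1 x H) => /andP[]. Qed.

Lemma perm_shift_bound m n w : is_perm n w -> all (fun v => m < v) [seq x + m | x <- w].
Proof. by move=> H; rewrite all_map; apply/allP => x; rewrite (perm_mem1 x H) /=; lia. Qed.

Lemma is_perm_dsum m n v w : is_perm m v -> is_perm n w -> is_perm (m + n) (dsum v w).
Proof.
move=> Hv Hw; rewrite /is_perm /dsum iotaD perm_cat //.
have -> : iota (1 + m) n = map (fun x => x + m) (iota 1 n).
  by rewrite addnC iotaDl; apply: eq_map => x; rewrite addnC.
by rewrite (perm_size1 Hv); apply: perm_map.
Qed.

Lemma free231_dsum n v w : is_perm (size v) v -> is_perm n w -> free231 v -> free231 w ->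
  free231 (dsum v w).
Proof.
move=> Pv Pw Fv Fw; apply: (@free231_cat (size v)) => //.
- exact: perm_bound.
- exact: perm_shift_bound Pw.
- exact: free231_shift.
Qed.

Lemma iota1S n : iota 1 n.+1 = iota 1 n ++ [:: n.+1].
Proof. by rewrite -(addn1 n) iotaD add1n addn1. Qed.

Lemma is_perm_maxE n w : is_perm n.+1 (n.+1 :: w) = is_perm n w.
Proof.
by rewrite /is_perm iota1S perm_sym -cat1s perm_catC perm_cat2l perm_sym.
Qed.

Lemma is_perm_max n w : is_perm n w -> is_perm n.+1 (n.+1 :: w).
Proof. by rewrite is_perm_maxE. Qed.

Lemma free231_max n w : is_perm n w -> free231 w -> free231 (n.+1 :: w).
Proof.
move=> Pw Fw a b c /=; case: eqP => [->|_]; last exact: Fw.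
move=> /mem_subseq H; have : b \in w by apply: H; rewrite !inE eqxx.
by rewrite (perm_mem1 _ Pw); lia.
Qed.

(** * Run lengths *)

(** Effect on the run lengths of a letter prepended to the first run. The value [[:: 1]] at [[::]]
    lets [runlens_cons_max] hold for the empty word too. *)
Definition inc (s : seq nat) : seq nat := if s is x :: s' then x.+1 :: s' else [:: 1].

Fixpoint runlens (e : rel nat) (s : seq nat) : seq nat :=
  if s is x :: s' then
    if s' is y :: _ then if e x y then inc (runlens e s') else 1 :: runlens e s'
    else [:: 1]
  else [::].

Lemma size_inc s : s != [::] -> size (inc s) = size s.
Proof. by case: s. Qed.

Lemma sumn_inc s : sumn (inc s) = (sumn s).+1.
Proof. by case: s. Qed.

Lemma runlens_cons2 e x y s : runlens e [:: x, y & s] =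
  if e x y then inc (runlens e (y :: s)) else 1 :: runlens e (y :: s).
Proof. by []. Qed.

Lemma runlens_nil e s : (runlens e s == [::]) = (s == [::]).
Proof. by case: s => [|x [|y s]] //; rewrite runlens_cons2; case: (e _ _); case: runlens. Qed.

Lemma inc_cat s t : s != [::] -> inc (s ++ t) = inc s ++ t.
Proof. by case: s. Qed.

Lemma runlens_cat e s x t : s != [::] -> ~~ e (last x s) x ->
  runlens e (s ++ x :: t) = runlens e s ++ runlens e (x :: t).
Proof.
elim: s => [//|z [|y s] IH] _; first by move=> /negPf /= ->.
move=> H; rewrite !cat_cons !runlens_cons2 -cat_cons IH //.
by case: (e _ _) => //; rewrite inc_cat // runlens_nil.
Qed.

Lemma runlens_cons_max e x s : (if s is y :: _ then e x y else true) ->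
  runlens e (x :: s) = inc (runlens e s).
Proof. by case: s => [|y s] //= ->. Qed.

Lemma runlens_map (e : rel nat) f s :
  {mono f : x y / e x y} -> runlens e (map f s) = runlens e s.
Proof.
move=> He; elim: s => [//|x [|y s] IH] //.
by rewrite !map_cons !runlens_cons2 -map_cons IH He.
Qed.

Lemma runlens_pos e s : all (leq 1) (runlens e s).
Proof.
elim: s => [//|x [|y s] IH] //; rewrite runlens_cons2.
case: (e _ _); last by rewrite /= IH.
by case: (runlens _ _) IH => [|z r] /= => [_|/andP[_ ->]].
Qed.

Lemma sumn_runlens e s : sumn (runlens e s) = size s.
Proof.
elim: s => [//|x [|y s] IH] //; rewrite runlens_cons2.
by case: (e _ _); rewrite ?sumn_inc /= IH.
Qed.

Lemma runlens_eq (e : rel nat) s t : size s = size t ->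
  (forall i, i.+1 < size s ->
     e (nth 0 s i) (nth 0 s i.+1) = e (nth 0 t i) (nth 0 t i.+1)) ->
  runlens e s = runlens e t.
Proof.
elim: s t => [|x [|y s] IH] [|x' [|y' t]] // [Hs] H.
have Ey := H 0 erefl; rewrite /= in Ey.
have /IH E : size (y :: s) = size (y' :: t) by rewrite /= Hs.
rewrite !runlens_cons2 Ey E // => i; apply: (H i.+1).
Qed.

(** * Positions of ascents and descents *)

Definition steps (e : rel nat) (s : seq nat) : seq nat :=
  [seq i <- iota 1 (size s).-1 | e (entry s i) (entry s i.+1)].

Lemma steps_cons e x y s :
  steps e [:: x, y & s] = (if e x y then [:: 1] else [::]) ++ map S (steps e (y :: s)).
Proof.
rewrite /steps /= /entry /=.
have -> : iota 2 (size s) = map S (iota 1 (size s)) by rewrite -(iotaDl 1).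
rewrite filter_map; set F := filter _ _; set G := filter _ _.
have -> : F = G by apply: eq_in_filter => i; rewrite mem_iota => /andP[]; case: i.
by case: (e _ _).
Qed.

Lemma steps_cat (e : rel nat) s x t : s != [::] ->
  steps e (s ++ x :: t) =
    steps e s ++ (if e (last x s) x then [:: size s] else [::])
      ++ map (addn (size s)) (steps e (x :: t)).
Proof.
elim: s => [//|z [|y s] IH] _; first by rewrite /= steps_cons.
rewrite -[_ ++ _]/([:: z, y & s ++ x :: t]) steps_cons -cat_cons IH // steps_cons.
rewrite !map_cat -catA; congr (_ ++ (_ ++ (_ ++ _))).
  by rewrite /=; case: (e _ _).
by rewrite -map_comp; apply: eq_map => i.
Qed.

Lemma mem_steps e s i : (i \in steps e s) =
  [&& 0 < i, i < size s & e (entry s i) (entry s i.+1)].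
Proof.
rewrite mem_filter mem_iota; case: (e _ _); rewrite ?andbT ?andbF //=; case: s => [|x s] //=; lia.
Qed.

Lemma steps_uniq e s : uniq (steps e s).
Proof. by rewrite filter_uniq // iota_uniq. Qed.

Lemma steps_map (e : rel nat) f s :
  {mono f : x y / e x y} -> steps e (map f s) = steps e s.
Proof.
move=> He; rewrite /steps size_map; apply: eq_in_filter => i.
rewrite mem_iota => /andP[i1 i2]; rewrite /entry !(nth_map 0) ?He //; lia.
Qed.

Lemma ascentsE s : ascents s = steps ltn s.
Proof. by []. Qed.

Lemma size_steps_ltn_gtn (s : seq nat) : uniq s ->
  size (steps ltn s) + size (steps gtn s) = (size s).-1.
Proof.
move=> Us; rewrite /steps !size_filter -[RHS](size_iota 1).
rewrite -[RHS](count_predC (fun i => ltn (entry s i) (entry s i.+1))); congr addn.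
apply: eq_in_count => i; rewrite mem_iota => /andP[i1 i2] /=.
have h1 : i.-1 < size s by lia.
have h2 : i < size s by lia.
have : entry s i != entry s i.+1 by rewrite /entry (nth_uniq 0 h1 h2 Us); lia.
lia.
Qed.


(** * Direct sums and their inverses *)

Lemma dsum0 v : dsum v [::] = v.
Proof. exact: cats0. Qed.

Lemma dsum0s v : dsum [::] v = v.
Proof. by rewrite /dsum /= -[RHS]map_id; apply: eq_map => x /=; rewrite addn0. Qed.

Lemma size_inverse w : size (inverse w) = size w.
Proof. by rewrite size_map size_iota. Qed.

Lemma inverse_bound w x : {subset iota 1 (size w) <= w} -> x \in inverse w ->
  0 < x <= size w.
Proof. by move=> H /mapP [v /H]; rewrite -index_mem => vw ->. Qed.

Lemma perm_mem_iota n w : is_perm n w -> {subset iota 1 (size w) <= w}.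
Proof. by move=> H x; rewrite (perm_size1 H) (perm_mem H). Qed.

Lemma inverse_dsum n v w : is_perm (size v) v -> is_perm n w ->
  inverse (dsum v w) = dsum (inverse v) (inverse w).
Proof.
move=> Pv Pw; rewrite /inverse /dsum size_cat !size_map iotaD map_cat size_iota.
congr (_ ++ _).
  apply/eq_in_map => x; rewrite mem_iota index_cat (perm_mem1 x Pv) => Hx.
  by rewrite ifT //; lia.
have -> : iota (1 + size v) (size w) = map (fun x => x + size v) (iota 1 (size w)).
  by rewrite addnC iotaDl; apply: eq_map => x; rewrite addnC.
rewrite -!map_comp; apply/eq_in_map => x; rewrite mem_iota => Hx /=.
rewrite index_cat (perm_mem1 _ Pv) ifF; last by lia.
rewrite -[x + _]/((fun z => z + size v) x) index_map; last by move=> y z /addIn.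
by rewrite addSn addnC.
Qed.

Lemma inverse_max n w : is_perm n w -> inverse (n.+1 :: w) = rcons (map S (inverse w)) 1.
Proof.
move=> Pw; have Sw := perm_size1 Pw.
rewrite /inverse (perm_size1 (is_perm_max Pw)) Sw -cats1.
rewrite iota1S map_cat /= eqxx -map_comp; congr (_ ++ _).
apply/eq_in_map => x; rewrite mem_iota /= => Hx.
by rewrite ifF //; apply/eqP; lia.
Qed.

(** Reversal puts the part from [w] first, and its letters exceed those from [v]; so the junction is
    a descent, which no increasing run crosses. *)
Lemma runlens_ltn_inverse_dsum n v w : is_perm (size v) v -> is_perm n w ->
  runlens ltn (rev (inverse (dsum v w))) =
    runlens ltn (rev (inverse w)) ++ runlens ltn (rev (inverse v)).
Proof.
move=> Pv Pw; rewrite (inverse_dsum Pv Pw) rev_cat -map_rev.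
rewrite -(@runlens_map ltn (fun x => x + size (inverse v)) (rev (inverse w))); last first.
  by move=> x y /=; rewrite ltn_add2r.
set s := map _ _; case E : (rev (inverse v)) => [|x t]; first by rewrite !cats0.
have [->//|s0] := eqVneq s [::].
apply: runlens_cat => //; rewrite -leqNgt.
have xv : x \in inverse v by rewrite -mem_rev E mem_head.
have /andP[_ xs] := inverse_bound (perm_mem_iota Pv) xv.
suff : last x s \in s by move=> /mapP [y _ ->]; rewrite size_inverse (leq_trans xs) // leq_addl.
by case: (s) s0 => //= y u _; apply: mem_last.
Qed.

Lemma runlens_ltn_inverse_max n w : is_perm n w ->
  runlens ltn (rev (inverse (n.+1 :: w))) = inc (runlens ltn (rev (inverse w))).
Proof.
move=> Pw; rewrite (inverse_max Pw) rev_rcons -map_rev runlens_cons_max.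
  by rewrite runlens_map // => x y /=; rewrite ltnS.
by case: (rev _) (mem_rev (inverse w)) => [//|y s] /(_ y); rewrite mem_head => /esym/mapP [v _ ->].
Qed.

Lemma last_dsum_lt n v w x : is_perm (size v) v -> is_perm n w -> v != [::] ->
  x \in [seq y + size v | y <- w] -> last 0 v < x.
Proof.
move=> Pv Pw v0 /mapP [y]; rewrite (perm_mem1 _ Pw) => /andP[y0 _ ->].
have : last 0 v \in v by case: (v) v0 => //= z s _; apply: mem_last.
rewrite (perm_mem1 _ Pv); lia.
Qed.

Lemma runlens_gtn_dsum n v w : is_perm (size v) v -> is_perm n w ->
  runlens gtn (dsum v w) = runlens gtn v ++ runlens gtn w.
Proof.
move=> Pv Pw; have [->|v0] := eqVneq v [::]; first by rewrite dsum0s.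
have L x := @last_dsum_lt _ _ _ x Pv Pw v0.
rewrite -(@runlens_map gtn (fun x => x + size v) w); last by move=> x y /=; rewrite ltn_add2r.
rewrite /dsum; case: (map _ w) L => [|x s] L; first by rewrite !cats0.
apply: runlens_cat => //; have := L x (mem_head _ _).
by case: (v) v0 => //= z u _; rewrite -leqNgt => /ltnW.
Qed.

Lemma runlens_gtn_max n w : is_perm n w ->
  runlens gtn (n.+1 :: w) = inc (runlens gtn w).
Proof.
move=> Pw; rewrite runlens_cons_max //; case: w Pw => [//|y s] Pw /=.
by have := perm_mem1 y Pw; rewrite mem_head; lia.
Qed.

(** The [nseq] term is the ascent at the junction of the two summands. *)
Lemma steps_ltn_dsum n v w : is_perm (size v) v -> is_perm n w -> v != [::] ->
  steps ltn (dsum v w) =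
    steps ltn v ++ nseq (w != [::]) (size v) ++ map (addn (size v)) (steps ltn w).
Proof.
move=> Pv Pw v0.
have L x := @last_dsum_lt _ _ _ x Pv Pw v0.
rewrite -(@steps_map ltn (fun x => x + size v) w); last by move=> x y /=; rewrite ltn_add2r.
have -> : (w != [::]) = ([seq x + size v | x <- w] != [::]) by case: (w).
rewrite /dsum; case: (map _ w) L => [|x s] L; first by rewrite !cats0.
rewrite steps_cat // ifT //; have := L x (mem_head _ _).
by case: (v) v0.
Qed.

Lemma steps_gtn_dsum n v w : is_perm (size v) v -> is_perm n w -> v != [::] ->
  steps gtn (dsum v w) = steps gtn v ++ map (addn (size v)) (steps gtn w).
Proof.
move=> Pv Pw v0.
have L x := @last_dsum_lt _ _ _ x Pv Pw v0.
rewrite -(@steps_map gtn (fun x => x + size v) w); last by move=> x y /=; rewrite ltn_add2r.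
rewrite /dsum; case: (map _ w) L => [|x s] L; first by rewrite !cats0.
rewrite steps_cat // ifF //; have := L x (mem_head _ _).
by case: (v) v0 => //= z u _; lia.
Qed.

Lemma steps_ltn_max n w : is_perm n w -> steps ltn (n.+1 :: w) = map S (steps ltn w).
Proof.
case: w => [//|y s] Pw; rewrite steps_cons ifF //.
by have := perm_mem1 y Pw; rewrite mem_head /=; lia.
Qed.

(** * Binary trees *)

Inductive tree := Leaf | Bin of tree & tree.

Fixpoint tsize (t : tree) : nat := if t is Bin l r then (tsize l).+1 + tsize r else 0.

(** The left subtree codes the first block of a 231-avoider without its leading maximum, the right
    subtree the remaining summands. *)
Fixpoint word (t : tree) : seq nat :=
  if t is Bin l r then dsum ((tsize l).+1 :: word l) (word r) else [::].

Lemma word_perm t : is_perm (tsize t) (word t).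
Proof. by elim: t => [//|l IHl r IHr] /=; apply: is_perm_dsum => //; apply: is_perm_max. Qed.

Lemma size_word t : size (word t) = tsize t.
Proof. exact: perm_size1 (word_perm t). Qed.

Lemma word_block_perm t : is_perm (size ((tsize t).+1 :: word t)) ((tsize t).+1 :: word t).
Proof. by rewrite /= size_word; apply: is_perm_max (word_perm t). Qed.

Lemma word_Bin l r : word (Bin l r) = dsum ((tsize l).+1 :: word l) (word r).
Proof. by []. Qed.

Lemma word_Bin_Leaf t : word (Bin t Leaf) = (tsize t).+1 :: word t.
Proof. exact: dsum0. Qed.

(** Strong induction on [n], and inside it induction on the list of blocks: the later blocks give
    the right subtree; the first block without its maximum is shorter than [w] and gives the left
    one. *)
Lemma word_surj n w : is_perm n w -> free231 w -> exists t, w = word t.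
Proof.
elim/ltn_ind: n w => n IH w Pw Fw.
have Aw : Sn_av n [:: 2; 3; 1] w by split; [|apply/avoids231P].
have [E Hb] := (blocksP (blocks w) Aw).2 erefl.
have Sw : size (dsums (blocks w)) <= n by rewrite E (perm_size1 Pw).
rewrite -E; elim: (blocks w) Hb Sw => [|b bs IHb] Hb Sw; first by exists Leaf.
rewrite /= /dsum size_cat size_map -/(dsums bs) in Sw.
have [r Er] : exists r, dsums bs = word r.
  apply: IHb => [c cb|]; last by apply: leq_trans Sw; apply: leq_addl.
  by apply: Hb; rewrite inE cb orbT.
have [b0 [[Pb /avoids231P Fb] Eb]] := Hb b (mem_head _ _).
case: b b0 Eb Pb Fb Sw {Hb} => [//|m b] _; rewrite /entry /= => -> Pb Fb Sw.
have Pb' : is_perm (size b) b by rewrite -is_perm_maxE.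
have [l El] : exists l, b = word l.
  apply: (IH (size b)) => //; first by lia.
  by apply: free231_sub Fb; apply: subseq_cons.
by exists (Bin l r); rewrite /= -/(dsums bs) Er El size_word.
Qed.

(** These are the c_i: read backwards, the descent runs of the inverse become increasing runs, and
    for a 231-avoider they then come in the order of the I_i, as [size_inv_descent_runs] shows. *)
Definition cs (t : tree) : seq nat := runlens ltn (rev (inverse (word t))).

Definition dl (t : tree) : seq nat := runlens gtn (word t).

Lemma cs_Bin l r : cs (Bin l r) = cs r ++ inc (cs l).
Proof.
rewrite /cs word_Bin (runlens_ltn_inverse_dsum (word_block_perm l) (word_perm r)).
by rewrite (runlens_ltn_inverse_max (word_perm l)).
Qed.

Lemma dl_Bin l r : dl (Bin l r) = inc (dl l) ++ dl r.
Proof.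
rewrite /dl word_Bin (runlens_gtn_dsum (word_block_perm l) (word_perm r)).
by rewrite (runlens_gtn_max (word_perm l)).
Qed.

Lemma asc_Bin l r : steps ltn (word (Bin l r)) =
  map S (steps ltn (word l)) ++ nseq (word r != [::]) (tsize l).+1
    ++ map (addn (tsize l).+1) (steps ltn (word r)).
Proof.
rewrite word_Bin (steps_ltn_dsum (word_block_perm l) (word_perm r)) //.
by rewrite (steps_ltn_max (word_perm l)) /= size_word.
Qed.

Lemma sumn_cs t : sumn (cs t) = tsize t.
Proof. by rewrite sumn_runlens size_rev size_inverse size_word. Qed.

Lemma cs_nil t : (cs t == [::]) = (word t == [::]).
Proof. by rewrite runlens_nil -!size_eq0 size_rev size_inverse. Qed.

Lemma size_cs_dl t : size (cs t) = size (dl t).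
Proof.
elim: t => [//|l IHl r IHr]; rewrite cs_Bin dl_Bin !size_cat IHr addnC; congr addn.
by case: (cs l) (dl l) IHl => [|x s] [|y u].
Qed.

Lemma size_cs_asc t : word t != [::] -> size (cs t) = (size (steps ltn (word t))).+1.
Proof.
elim: t => [//|l IHl r IHr] _.
rewrite cs_Bin asc_Bin !size_cat !size_map size_nseq.
have -> : size (inc (cs l)) = (size (steps ltn (word l))).+1.
  have [El|l0] := eqVneq (word l) [::]; first by rewrite /cs El.
  by rewrite size_inc ?cs_nil // IHl.
have [Er|r0] := eqVneq (word r) [::]; first by rewrite /cs Er /=; lia.
by rewrite IHr //; lia.
Qed.

(* For the block [Bin t Leaf], whose ascents are those of [t] shifted by one, this says that round [i]
   of the stack procedure finds an element of the set M. *)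
Lemma cs_dyck t i : 0 < i < size (cs t) ->
  i <= count (fun a => tsize t <= a + sumn (take i (cs t))) (steps ltn (word t)).
Proof.
elim: t i => [|l IHl r IHr] i; first by rewrite /cs /=; lia.
rewrite cs_Bin asc_Bin !count_cat size_cat => /andP[i0 ik].
(* The runs of [r] are read before those of [l], so the early rounds concern [r] alone. *)
have [ir|ri] := ltnP i (size (cs r)).
  rewrite take_cat ir; have /IHr : 0 < i < size (cs r) by rewrite i0.
  move=> H; apply: leq_trans H _.
  apply: leq_trans (leq_addl _ _); apply: leq_trans (leq_addl _ _).
  by rewrite count_map; apply: sub_count => a /=; lia.
(* Once all runs of a nonempty [r] are read, its ascents and the one at the junction all pass the
   threshold; together they number [size (cs r)]. *)
have Hr : size (cs r) <= count (fun a => tsize (Bin l r) <= a + sumn (take i (cs r ++ inc (cs l))))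
    (nseq (word r != [::]) (tsize l).+1) +
  count (fun a => tsize (Bin l r) <= a + sumn (take i (cs r ++ inc (cs l)))) 
   [seq (tsize l).+1 + i | i <- steps ltn (word r)].
  have [Er|r0] := eqVneq (word r) [::]; first by rewrite /cs Er.
  rewrite size_cs_asc // take_cat (ltnNge i) ri /= sumn_cat sumn_cs count_map.
  rewrite [count _ (steps _ _)](_ : _ = size (steps ltn (word r))); first by lia.
  by apply/eqP; rewrite -all_count; apply/allP => a _ /=; lia.
(* The other [i - size (cs r)] rounds are served by the ascents of [l]. *)
rewrite -[leqLHS](subnK ri); apply: leq_add Hr.
rewrite take_cat (ltnNge i) ri /= count_map sumn_cat sumn_cs.
case: (posnP (i - size (cs r))) => [->//|j0].
have [El|l0] := eqVneq (word l) [::].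
  by move: ik; rewrite /cs El /=; lia.
move: ik; rewrite size_inc ?cs_nil // => ik.
have /IHl : 0 < i - size (cs r) < size (cs l) by rewrite j0 ltn_subLR.
move=> H; apply: leq_trans H _; apply: sub_count => a /=.
case: (i - _) j0 => // j _; case: (cs l) => /= [|x s]; lia.
Qed.

(** * A tree is determined by its two sequences of run lengths *)

Fixpoint dyck (t : tree) : seq bool :=
  if t is Bin l r then true :: dyck l ++ false :: dyck r else [::].

(** The suffixes are there for the induction: in [dyck] the code of a left subtree is followed by
    [false], and a suffix not starting with an up step shows where a code ends. The default [false]
    admits the empty suffix. *)
Lemma dyck_inj t t' x x' : ~~ nth false x 0 -> ~~ nth false x' 0 ->
  dyck t ++ x = dyck t' ++ x' -> t = t' /\ x = x'.
Proof.
elim: t t' x x' => [|l IHl r IHr] [|l' r'] x x' /= Hx Hx'.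
- by [].
- by move=> E; rewrite E in Hx.
- by move=> E; rewrite -E in Hx'.
case; rewrite -!catA !cat_cons => /IHl [] // -> [] /IHr [] // -> ->.
by [].
Qed.

Fixpoint updown (d r : seq nat) : seq bool :=
  match d, r with
  | x :: d', y :: r' => nseq x true ++ nseq y false ++ updown d' r'
  | _, _ => [::]
  end.

Lemma updown_cat d r d' r' : size d = size r ->
  updown (d ++ d') (r ++ r') = updown d r ++ updown d' r'.
Proof.
by elim: d r => [|x d IH] [|y r] //= [/IH ->]; rewrite !catA.
Qed.

Lemma updown_rcons d r y : size d = (size r).+1 ->
  updown d (rcons r y.+1) = updown d (rcons r y) ++ [:: false].
Proof.
elim: d r => [|x d IH] [|z r] //= [H].
  case: d {IH} H => //= _; rewrite !cats0 -catA; congr (_ ++ _).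
  by elim: y => //= y <-.
by rewrite IH // !catA.
Qed.

(** [inc] lengthens the first up run and, after the reversal, the last down run. This encloses the
    word between an up and a down step, as [dyck] does with a left subtree. *)
Lemma updown_inc d c : size d = size c -> 
  updown (inc d) (rev (inc c)) = true :: updown d (rev c) ++ [:: false].
Proof.
case: d c => [|x d] [|y c] // [H].
rewrite [inc _]/= [inc (y :: c)]/= !rev_cons -updown_rcons ?size_rev /= ?H //.
by case: (rev c).
Qed.

Lemma dyckE t : dyck t = updown (dl t) (rev (cs t)).
Proof.
elim: t => [//|l IHl r IHr] /=; rewrite cs_Bin dl_Bin rev_cat updown_cat.
  by rewrite updown_inc -?size_cs_dl // IHl IHr /= -catA.
by rewrite size_rev; have := size_cs_dl l; case: (cs l) (dl l) => [|? ?] [].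
Qed.

Lemma cs_asc_inj t t' : cs t = cs t' -> steps ltn (word t) = steps ltn (word t') -> t = t'.
Proof.
move=> Ec Ea.
have Es : tsize t = tsize t' by rewrite -!sumn_cs Ec.
(* Letters are distinct, so the descents are the positions that are not ascents; length and ascents
   thus fix the descent run lengths. *)
have Ed : dl t = dl t'.
  apply: runlens_eq; rewrite !size_word // => i it.
  have := mem_steps ltn (word t) i.+1; rewrite Ea mem_steps !size_word -Es it /entry /=.
  have U1 := perm_uniq1 (word_perm t); have U2 := perm_uniq1 (word_perm t').
  have it' : i < tsize t by lia.
  have := nth_uniq 0 (i := i) (j := i.+1) _ _ U1.
  have := nth_uniq 0 (i := i) (j := i.+1) _ _ U2.
  rewrite !size_word -Es => /(_ it' it) N2 /(_ it' it) N1.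
  have gtnE a b : a != b -> (b < a) = ~~ (a < b) by lia.
  move=> E; rewrite /= [LHS]gtnE ?N1 ?(ltn_eqF (ltnSn i)) //.
  by rewrite [RHS]gtnE ?N2 ?(ltn_eqF (ltnSn i)) // E.
have := @dyck_inj t t' [::] [::] isT isT; rewrite !cats0 !dyckE Ec Ed.
by case.
Qed.


(** * The stack procedure *)

(** The output reads [B] from its top, so neighbours [a], [b] in it mean that [b] was popped just
    before [a]. *)
Definition linked (M : seq nat) : rel nat := fun a b => (a < b) == (b \in M).

(* In the pattern condition, [a] is still to be popped, hence ends up to the left of [x] and [y]. *)
Definition stack_inv (n p : nat) (A B : seq nat) : Prop :=
  [/\ p <= n, perm_eq (A ++ B) (iota p.+1 (n - p)), sorted ltn A,
      forall a x y : nat, a \in A -> subseq [:: x; y] B -> ~~ ((y < a) && (a < x))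
    & free231 B].

Lemma stack_inv_gt n p A B x : stack_inv n p A B -> x \in A ++ B -> p < x.
Proof. by case=> _ /perm_mem-> _ _ _; rewrite mem_iota => /andP[]. Qed.

(** The new letter is below everything on the stacks, so it cannot be the 2 of a 231 whose 3 and 1
    are in [B]. *)
Lemma stack_inv_push n p A B : stack_inv n p.+1 A B -> stack_inv n p (p.+1 :: A) B.
Proof.
move=> I; have gt := stack_inv_gt I; case: I => pn P S H F; split=> //.
- exact: ltnW.
- by rewrite -[n - p]prednK ?subn_gt0 // /= perm_cons -subnS.
- rewrite /= path_min_sorted //; apply/allP => x xA; apply: gt.
  by rewrite mem_cat xA.
move=> a x y; rewrite inE => /orP[/eqP->|]; last exact: H.
move=> /mem_subseq xy; have /gt : y \in A ++ B.
  by rewrite mem_cat xy ?orbT // !inE eqxx orbT.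
lia.
Qed.

Lemma stack_inv_pushes n p c A B : stack_inv n p A B -> c <= p ->
  stack_inv n (p - c) (iota (p - c).+1 c ++ A) B.
Proof.
move=> I; elim: c => [|c IH] cp; first by rewrite subn0.
rewrite /=; apply: stack_inv_push.
have -> : (p - c.+1).+1 = p - c by lia.
exact: IH (ltnW cp).
Qed.

(** The top [a] is the smallest letter of [A], so it cannot be the 3 for a letter left on [A]; as a
    2 it is excluded by the pattern clause of the invariant. *)
Lemma stack_inv_pop n p a A B : stack_inv n p (a :: A) B -> stack_inv n p A (a :: B).
Proof.
case=> pn P S H F; split=> //.
- by rewrite -cat1s perm_catCA.
- exact: path_sorted S.
- move=> b x y bA /=; case: eqP => [->|_].
    by move: S => /= /(order_path_min ltn_trans)/allP/(_ b bA); lia.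
  by apply: H; rewrite inE bA orbT.
- move=> b x y /=; case: eqP => [->|_]; last exact: F.
  by apply: H; rewrite mem_head.
Qed.

Lemma push_downE c A p : c <= p -> push_down c A p = (iota (p - c).+1 c ++ A, p - c).
Proof.
elim: c A p => [|c IH] A p cp; first by rewrite subn0.
rewrite [push_down _ _ _]/= IH; last by lia.
have -> : p.-1 - c = p - c.+1 by lia.
have -> : iota (p - c.+1).+1 c.+1 = iota (p - c.+1).+1 c ++ [:: p].
  by rewrite -(addn1 c) iotaD; congr (_ ++ [:: _]); lia.
by rewrite -catA.
Qed.

(** The condition on [a :: B] anticipates the next pop. After a letter outside [M] the next top is
    larger, since [A] increases from its top, and this is what [linked] demands. *)
Lemma pop_whileP n p M A B :
  stack_inv n p A B -> sorted (linked M) (if A is a :: _ then a :: B else B) ->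
  let: (A', B') := pop_while M A B in
  [/\ stack_inv n p A' B', sorted (linked M) (if A' is a :: _ then a :: B' else B'),
      (if A' is a :: _ then a \in M else true)
    & count (mem M) A' = count (mem M) A].
Proof.
elim: A B => [|a A IH] B I S; first by [].
rewrite [pop_while _ _ _]/=; case: ifP => aM; first by split.
have S' : sorted (linked M) (if A is a' :: _ then a' :: a :: B else a :: B).
  case: (A) I S => [//|a' A0] [_ _ /= /andP[aa' _] _ _] /= ->; rewrite andbT.
  by rewrite /linked aM; apply/eqP; lia.
have := IH (a :: B) (stack_inv_pop I) S'; case: pop_while => A' B' [I' SA HA ->].
by rewrite /= aM.
Qed.

(** Between rounds the head of [B] is the letter of [M] popped in step (3). The inequalities ensure
    that every round but the last finds a letter of [M] on [A]; the equality ensures that the last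
    finds none and empties [A]. *)
Lemma stack_loopP n M cs A B p :
  stack_inv n p A B -> cs != [::] -> all (leq 1) cs -> sumn cs = p ->
  sorted (linked M) B -> (if B is b :: _ then b \in M else true) ->
  (forall i, 0 < i < size cs -> i <= count (mem M) A +
     count (mem M) (iota (p - sumn (take i cs)).+1 (sumn (take i cs)))) ->
  count (mem M) A + count (mem M) (iota 1 p) = (size cs).-1 ->
  [/\ is_perm n (stack_loop cs M A B p), free231 (stack_loop cs M A B p)
    & sorted (linked M) (stack_loop cs M A B p)].
Proof.
elim: cs A B p => [//|c cs IH] A B p I _ /= /andP[c0 pos] Ep SB HB HM Hn.
have cp : c <= p by lia.
rewrite push_downE //; have I1 := stack_inv_pushes I cp.
set A1 := iota _ c ++ A in I1 *.
(* A freshly pushed letter is smaller than the head [b] of [B], as [b \in M] requires. *)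
have S1 : sorted (linked M) (if A1 is a :: _ then a :: B else B).
  rewrite /A1; case: (c) c0 cp => //= c1 _ cp.
  case: (B) SB HB I => //= b B' -> bM I; rewrite andbT /linked bM.
  have /(stack_inv_gt I) : b \in A ++ b :: B' by rewrite mem_cat mem_head orbT.
  by move=> pb; apply/eqP; lia.
have C1 : count (mem M) A1 = count (mem M) A + count (mem M) (iota (p - c).+1 c).
  by rewrite /A1 count_cat addnC.
have := pop_whileP I1 S1; case: pop_while => A2 B2 [I2 S2 H2 C2].
case: cs IH pos Ep HM Hn => [|c' cs] IH pos Ep HM Hn.
  have Ec : p = c by rewrite -Ep /= addn0.
  have A20 : A2 = [::].
    case: A2 H2 C2 {I2 S2} => // a A2 /= aM; rewrite C1 Ec subnn -Ec Hn aM /=; lia.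
  rewrite A20 /= in I2 S2 *; case: I2 => _ P _ _ F; split=> //.
  by rewrite /is_perm (permPl P) Ec subnn subn0.
(* The inequality for 1 serves the current round; those for [i.+1] become the hypothesis for the
   rounds left. *)
have A2n : 0 < count (mem M) A2.
  by have := HM 1 isT; rewrite /= addn0 C2 C1.
case: A2 I2 S2 H2 C2 A2n => [//|a A2] I2 S2 aM C2 _; rewrite [pop_one _ _]/=.
have C3 : (count (mem M) A2).+1 = count (mem M) A + count (mem M) (iota (p - c).+1 c).
  by rewrite -C1 -C2 /= aM.
apply: IH => //.
- exact: stack_inv_pop.
- by rewrite -Ep /= addKn.
- move=> i /andP[i0 ik]; have /HM /= : 0 < i.+1 < (size (c' :: cs)).+1 by [].
  set s := sumn _; have sp : s <= p - c.
    rewrite -Ep addKn -[X in _ <= sumn X](cat_take_drop i (c' :: cs)) sumn_cat; exact: leq_addr.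
  have -> : iota (p - (c + s)).+1 (c + s) = iota (p - c - s).+1 s ++ iota (p - c).+1 c.
    rewrite addnC iotaD; congr (iota _ _ ++ iota _ _); lia.
  by rewrite count_cat addnCA -C3 addnS ltnS addnC.
move: Hn; rewrite -[p in iota 1 p](subnK cp) iotaD count_cat add1n addnCA -C3 addnS => <-; exact: addnC.
Qed.

Lemma stack_procedureP cs M : cs != [::] -> all (leq 1) cs ->
  (forall i, 0 < i < size cs -> i <=
     count (mem M) (iota (sumn cs - sumn (take i cs)).+1 (sumn (take i cs)))) ->
  count (mem M) (iota 1 (sumn cs)) = (size cs).-1 ->
  [/\ is_perm (sumn cs) (stack_procedure cs M), free231 (stack_procedure cs M)
    & sorted (linked M) (stack_procedure cs M)].
Proof.
move=> c0 pos H1 H2; apply: stack_loopP => //.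
by split=> //; rewrite subnn.
Qed.

(** * Recovering the input of the stack procedure from its output *)

Lemma pop_while_cat M A B : exists X, (pop_while M A B).2 = X ++ B.
Proof.
elim: A B => [|a A IH] B /=; first by exists [::].
case: ifP => _; first by exists [::].
by have [X ->] := IH (a :: B); exists (rcons X a); rewrite cat_rcons.
Qed.

Lemma stack_loop_cat cs M A B p : exists X, stack_loop cs M A B p = X ++ B.
Proof.
elim: cs A B p => [|c cs IH] A B p /=; first by exists [::].
case: push_down => A1 p1; have [X] := pop_while_cat M A1 B.
case: pop_while => A2 B2 /= ->.
case: A2 => [|a A2] /=; first by have [Y ->] := IH [::] (X ++ B) p1; exists (Y ++ X); rewrite catA.
by have [Y ->] := IH A2 (a :: X ++ B) p1; exists (Y ++ a :: X); rewrite -catA.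
Qed.

(** The last letter pushed is on top of [A] and is popped first, in step (2) if it is outside [M]
    and in step (3) otherwise; it lands directly on the old [B]. *)
Lemma stack_loop_first c cs M A B p : 0 < c <= p ->
  exists X, stack_loop (c :: cs) M A B p = X ++ (p - c).+1 :: B.
Proof.
move=> /andP[c0 cp]; rewrite /= push_downE //; case: c c0 cp => [//|c] _ cp /=.
case: ifP => _ /=; first exact: stack_loop_cat.
set A1 := iota _ _ ++ A; have [X] := pop_while_cat M A1 ((p - c.+1).+1 :: B).
case: pop_while => A2 B2 /= ->.
case: A2 => [|a A2] /=.
  have [Y ->] := stack_loop_cat cs M [::] (X ++ (p - c.+1).+1 :: B) (p - c.+1).
  by exists (Y ++ X); rewrite catA.
have [Y ->] := stack_loop_cat cs M A2 (a :: X ++ (p - c.+1).+1 :: B) (p - c.+1).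
by exists (Y ++ a :: X); rewrite -catA.
Qed.

Lemma cat_cons_inj (X Y : seq nat) x y B : X ++ x :: B = Y ++ y :: B -> x = y.
Proof.
move=> /(congr1 (fun s => nth 0 (rev s) (size B))).
by rewrite !rev_cat !rev_cons !nth_cat !size_rcons !size_rev ltnSn !nth_rcons size_rev ltnn eqxx.
Qed.

Lemma stack_loop_neq c cs M A B p : all (leq 1) (c :: cs) -> sumn (c :: cs) <= p ->
  stack_loop (c :: cs) M A B p <> B.
Proof.
move=> /= /andP[c0 _] cp; have [|X] := @stack_loop_first c cs M A B p; first by lia.
by move=> /= -> /(congr1 size); rewrite size_cat /=; lia.
Qed.

(** The letter directly above [B] in the output reveals the first entry of the list, by
    [stack_loop_first]; the two executions then reach the same state. *)
Lemma stack_loop_inj cs1 cs2 M A B p : all (leq 1) cs1 -> all (leq 1) cs2 ->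
  sumn cs1 <= p -> sumn cs2 <= p ->
  stack_loop cs1 M A B p = stack_loop cs2 M A B p -> cs1 = cs2.
Proof.
elim: cs1 cs2 A B p => [|c1 cs1 IH] [|c2 cs2] A B p pos1 pos2 s1 s2 E //.
- by case: (stack_loop_neq pos2 s2 (esym E)).
- by case: (stack_loop_neq pos1 s1 E).
move: pos1 pos2 => /= /andP[p1 pos1] /andP[p2 pos2]; rewrite /= in s1 s2.
have [|X1 E1] := @stack_loop_first c1 cs1 M A B p; first by lia.
have [|X2 E2] := @stack_loop_first c2 cs2 M A B p; first by lia.
have Ec : c1 = c2 by have := E; rewrite E1 E2 => /cat_cons_inj; lia.
move: E; rewrite -Ec /= push_downE; last by lia.
case: pop_while => A2 B2; case: pop_one => A3 B3 /IH -> //; lia.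
Qed.


(** * Inverse descent runs *)

(* The maximal intervals of [{1, ..., n}] all of whose positions but the last satisfy [d],
   from right to left. *)
Fixpoint chains (d : pred nat) (n : nat) : seq (nat * nat) :=
  if n is m.+1 then
    if (0 < m) && d m then
      if chains d m is ij :: q then (ij.1, n) :: q else [::]
    else (n, n) :: chains d m
  else [::].

Definition is_chain (d : pred nat) (n : nat) (ij : nat * nat) : Prop :=
  [/\ 0 < ij.1 <= ij.2, ij.2 <= n, forall p, ij.1 <= p < ij.2 -> d p,
      1 < ij.1 -> ~~ d ij.1.-1 & ij.2 < n -> ~~ d ij.2].

(** The first clause is needed in the induction: it shows that the inner default [[::]] of [chains]
    is never reached and that the chain being extended ends at [n]. *)
Lemma chainsP d n :
  [/\ 0 < n -> exists i q, chains d n = (i, n) :: q,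
      pairwise (fun x y : nat * nat => y.2 < x.1) (chains d n),
      forall ij : nat * nat, ij \in chains d n -> is_chain d n ij
    & forall p, 0 < p <= n -> exists2 ij : nat * nat, ij \in chains d n & ij.1 <= p <= ij.2].
Proof.
elim: n => [|n [H1 H2 H3 H4]]; first by split=> // -[|p].
rewrite /=; case: ifP => [/andP[n0 dn]|dn].
  have [i [q E]] := H1 n0; rewrite E /= in H2 H3 H4 *.
  case/andP: H2 => Hq Pq; split.
  - by exists i, q.
  - by rewrite Hq.
  - move=> ij; rewrite inE => /orP[/eqP->|ijq].
      have [/= a1 a2 a3 a4 a5] := H3 (i, n) (mem_head _ _); split=> //=; try lia.
      move=> p; case: (ltnP p n) => pn ip; first by apply: a3; lia.
      by have -> : p = n by lia.
    have ijn : ij.2 < n.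
      have [/= a1 _ _ _ _] := H3 (i, n) (mem_head _ _).
      by have /= := allP Hq _ ijq; lia.
    have [|a1 a2 a3 a4 a5] := H3 ij; first by rewrite inE ijq orbT.
    by split=> //; lia || (move=> _; apply: a5).
  - move=> p p0; have [pn|pn] := ltnP n p.
      exists (i, n.+1); first exact: mem_head.
      have [/= a1 _ _ _ _] := H3 (i, n) (mem_head _ _); lia.
    have [|ij] := H4 p; first by lia.
    rewrite inE => /orP[/eqP->/= ip|ijq]; last by exists ij => //; rewrite inE ijq orbT.
    by exists (i, n.+1); [exact: mem_head | rewrite /=; lia].
split.
- by exists n.+1, (chains d n).
- by rewrite /= H2 andbT; apply/allP => ij /H3[_ a2 _ _ _] /=; lia.
- move=> ij; rewrite inE => /orP[/eqP->|/H3[a1 a2 a3 a4 a5]].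
    split=> //=; try lia.
  split=> //; first by lia.
  move=> _; case: (ltnP ij.2 n) => [|nj]; first exact: a5.
  have E : ij.2 = n by lia.
  by move: dn; rewrite E (_ : 0 < n) /= => [->|]; last by lia.
move=> p p0; have [pn|pn] := ltnP n p.
  by exists (n.+1, n.+1); [exact: mem_head | rewrite /=; lia].
have [|ij ijn pij] := H4 p; first by lia.
by exists ij; rewrite // inE ijn orbT.
Qed.

Lemma decreasing_onP tau i j : i <= j ->
  reflect (forall p, i <= p < j -> entry tau p.+1 < entry tau p) (decreasing_on tau (i, j)).
Proof.
move=> ij; have Sz : size [seq entry tau p | p <- positions (i, j)] = (j - i).+1.
  by rewrite size_map size_iota.
have N k : k < (j - i).+1 ->
    nth 0 [seq entry tau p | p <- positions (i, j)] k = entry tau (i + k).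
  by move=> kn; rewrite (nth_map 0) ?size_iota // nth_iota.
apply: (iffP (sortedP 0)); rewrite Sz => H p Hp.
  have := H (p - i); rewrite !N; try lia.
  by rewrite addnS subnKC; [apply; lia | lia].
by rewrite !N ?addnS; [apply: H | |]; lia.
Qed.

Lemma mem_intervals n (ij : nat * nat) : (ij \in intervals n) = [&& 0 < ij.1, ij.1 <= ij.2 & ij.2 <= n].
Proof.
case: ij => i j; rewrite mem_filter /=; apply/andP/idP.
  move=> [ij /allpairsP [[x y] /= [+ + [Ex Ey]]]]; rewrite -Ex -Ey !mem_iota; lia.
move=> H; split; first by lia.
by apply/allpairsP; exists (i, j); rewrite !mem_iota; split=> //=; lia.
Qed.

Lemma intervals_uniq n : uniq (intervals n).
Proof.
rewrite filter_uniq // allpairs_uniq ?iota_uniq // => x y _ _.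
by case: x y => [a b] [a' b'].
Qed.

Lemma descent_runs_chains tau :
  perm_eq [seq ij <- intervals (size tau) | is_descent_run tau ij]
    (chains (fun p => entry tau p.+1 < entry tau p) (size tau)).
Proof.
set d := (fun p => entry tau p.+1 < _); have [H1 H2 H3 H4] := chainsP d (size tau).
apply: uniq_perm; first by rewrite filter_uniq // intervals_uniq.
  have {}H2 : pairwise (fun x y : nat * nat => (y.2 < x.1) && (x != y)) (chains d (size tau)).
    elim: (chains _ _) H2 H3 => //= x s IH /andP[xs /IH {}IH] H3.
    rewrite IH ?andbT => [|ij ijs]; last by apply: H3; rewrite inE ijs orbT.
    apply/allP => y ys; have := allP xs y ys; move=> -> /=; apply/eqP => E.
    have [a1 _ _ _ _] := H3 x (mem_head _ _); have := allP xs y ys; rewrite -E; lia.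
  by apply: pairwise_uniq H2 => x; rewrite eqxx andbF.
case=> i j; rewrite mem_filter mem_intervals /=; apply/idP/idP.
  case/andP=> /andP[dij maxij] ijn.
  have {}dij := decreasing_onP _ (i := i) (j := j) _ dij.
  (* The chain [(k, l)] through [i] and the run [(i, j)] have the decreasing union [(k, maxn l j)],
     so maximality of the run gives [k = i] and [l <= j]; [l < j] would contradict maximality of the
     chain. *)
  have [|[k l] klc ikl] := H4 i; first by lia.
  have [/= k0 ln dkl _ dl] := H3 _ klc.
  have := allP maxij (k, maxn l j); rewrite mem_intervals /=.
  have Dec : decreasing_on tau (k, maxn l j).
    apply/decreasing_onP => [|p pk]; first by lia.
    case: (ltnP p l) => pl; first by apply: dkl; lia.
    by apply: dij; rewrite /= in ikl *; lia.
  rewrite /= in ikl; rewrite Dec => /(_ ltac:(lia)) /implyP/(_ ltac:(lia))/eqP[Ek El].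
  rewrite Ek in klc dl; have [//|/dl] : j = l \/ l < size tau by lia.
    by move=> ->.
  move=> ndl; have : l <> j -> d l by move=> lj; apply: dij; lia.
  have [E _|/eqP lj /(_ lj) dl'] := eqVneq l j; [by rewrite -[in (i, j)]E | by case/negP: ndl].
move/H3 => [/= ij0 jn dij di dj]; apply/andP; split; last by lia.
rewrite /is_descent_run; apply/andP; split; first by apply/decreasing_onP => //; lia.
apply/allP => -[k l]; rewrite mem_intervals => kl; apply/implyP => /and3P[dkl /= ki jl].
have {}dkl := decreasing_onP _ (i := k) (j := l) _ dkl.
rewrite /= in kl; rewrite xpair_eqE; apply/andP; split.
  case: (ltngtP k i) => //; [move=> ki'|lia].
  have /negP[] : ~~ d i.-1 by apply: di; lia.
  by apply: dkl; lia.
case: (ltngtP l j) => //; [lia|move=> lj].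
have /negP[] : ~~ d j by apply: dj; lia.
by apply: dkl; lia.
Qed.

Lemma smax_decreasing x s : path gtn x s -> smax (x :: s) = x.
Proof.
rewrite (path_sortedE (rev_trans ltn_trans)) => /andP[H _].
rewrite /smax /= -/(smax s); apply/maxn_idPl.
elim: s H => //= y s IH /andP[yx /IH]; rewrite /smax /= -/(smax s); lia.
Qed.

Lemma smax_chain tau i j : decreasing_on tau (i, j) ->
  smax [seq entry tau v | v <- positions (i, j)] = entry tau i.
Proof. exact: smax_decreasing. Qed.

Lemma entry_inverse n w v : is_perm n w -> 0 < v <= n ->
  entry (inverse w) v = (index v w).+1.
Proof.
move=> Pw Hv; rewrite /entry /inverse (perm_size1 Pw) (nth_map 0) ?size_iota; last by lia.
rewrite nth_iota; last by lia.
by rewrite add1n prednK; [|lia].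
Qed.

(** [chains] goes from right to left, and for a 231-avoider this is the order of decreasing maxima,
    so sorting yields exactly this list. *)
Lemma inv_descent_runsE n w : is_perm n w -> free231 w ->
  inv_descent_runs w =
    [seq [seq entry (inverse w) v | v <- positions ij]
       | ij <- chains (fun p => entry (inverse w) p.+1 < entry (inverse w) p) n].
Proof.
move=> Pw Fw; have Sw := perm_size1 Pw.
rewrite /inv_descent_runs; set tau := inverse w.
have St : size tau = n by rewrite size_inverse.
set d := (fun p => entry tau p.+1 < _); set F := fun ij : nat * nat => [seq entry tau v | v <- positions ij].
set leT := fun D E => _.
have [_ H2 H3 _] := chainsP d n.
have smF (ij : nat * nat) : ij \in chains d n -> smax (F ij) = entry tau ij.1.
  case: ij => i j /H3 [/= ij _ dij _ _]; apply: smax_chain; apply/decreasing_onP => //; lia.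
have tE v : 0 < v <= n -> entry tau v = (index v w).+1 by apply: entry_inverse.
have iinj (u v : nat) : 0 < u <= n -> index u w = index v w -> u = v.
  move=> Hu E; have := nth_index 0 (x := u) (s := w).
  rewrite (perm_mem1 u Pw) Hu E => /(_ isT) <-; apply: nth_index.
  by rewrite -index_mem -E index_mem (perm_mem1 u Pw).
(* Since a chain starts at [x.1], the value [x.1.-1] stands before [x.1] in [w]; if [y.1] stood
   after [x.1], the three would form a 231. *)
have start (x y : nat * nat) : x \in chains d n -> y \in chains d n -> y.2 < x.1 ->
    entry tau y.1 < entry tau x.1.
  move=> /H3 [x0 xn _ dx _] /H3 [y0 _ _ _ _] yx.
  have /dx : 1 < x.1 by lia.
  rewrite /d prednK; last by lia.
  rewrite !tE; try lia.
  rewrite -leqNgt !ltnS => Hx.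
  have {}Hx : index x.1.-1 w < index x.1 w.
    rewrite ltn_neqAle; apply/andP; split; last by lia.
    by apply/eqP => /iinj; lia.
  rewrite ltnNge; apply/negP => xy.
  have {}xy : index x.1 w < index y.1 w.
    rewrite ltn_neqAle; apply/andP; split; last by lia.
    by apply/eqP => /iinj; lia.
  have y1w : y.1 \in w by rewrite (perm_mem1 _ Pw); lia.
  have := Fw _ _ _ (subseq_index3 Hx xy y1w).
  have : y.1 != x.1.-1 by apply/eqP => E; rewrite E in xy; lia.
  lia.
(* Distinct chains have distinct maxima, so the sorted list does not depend on the order of the
   input. *)
have runinj (x y : nat * nat) : x \in chains d n -> y \in chains d n ->
    entry tau x.1 = entry tau y.1 -> x = y.
  move=> xc yc E1; have [x0 xn _ _ _] := H3 x xc; have [y0 yn _ _ _] := H3 y yc.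
  have Exy : x.1 = y.1 by apply: iinj; [|apply: succn_inj; rewrite -!tE //]; lia.
  elim: (chains d n) H2 H3 xc yc {E1 smF start} => //= z s IH /andP[zs /IH {}IH] H3.
  have H3' (u : nat * nat) : u \in s -> u.1 <= u.2 < z.1.
    move=> us; have := allP zs u us; have [|u0 _ _ _ _] := H3 u; first by rewrite inE us orbT.
    lia.
  rewrite !inE => /orP[/eqP Ex|xs] /orP[/eqP Ey|ys].
  - by rewrite Ex Ey.
  - by have := H3' _ ys; rewrite -Exy Ex; lia.
  - by have := H3' _ xs; rewrite Exy Ey; lia.
  by apply: IH => // u us; apply: H3; rewrite inE us orbT.
have P : perm_eq [seq [seq entry tau v | v <- R] | R <- descent_runs tau] (map F (chains d n)).
  rewrite /descent_runs -map_comp; apply: perm_map.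
  by rewrite -St; apply: descent_runs_chains.
clearbody F.
have T : transitive leT by move=> E D G; rewrite /leT; lia.
rewrite (_ : sort _ _ = sort leT (map F (chains d n))).
  apply: sorted_sort => //; apply: pairwise_sorted; rewrite pairwise_map.
  have {}H2 : pairwise (fun x y => entry tau y.1 < entry tau x.1) (chains d n).
    elim: (chains d n) H2 start => //= x s IH /andP[xs /IH {}IH] st.
    rewrite IH => [|u v us vs]; last by apply: st; rewrite inE ?us ?vs orbT.
    rewrite andbT; apply/allP => y ys; apply: st; rewrite ?inE ?eqxx ?ys ?orbT //.
    exact: (allP xs).
  elim: (chains d n) H2 smF => //= x s IH /andP[xs /IH {}IH] sm.
  rewrite IH => [|y ys]; last by apply: sm; rewrite inE ys orbT.
  rewrite andbT; apply/allP => y ys; change (smax (F y) <= smax (F x)); rewrite !sm ?inE ?eqxx ?ys ?orbT //.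
  exact: ltnW (allP xs y ys).
apply/perm_sort_inP => //.
- by move=> E D _ _; apply: leq_total.
- by move=> E D G _ _ _; apply: T.
move=> E D; rewrite !(perm_mem P) => /mapP [x xc ->] /mapP [y yc ->].
rewrite /leT !smF // -eqn_leq => /eqP E1.
by congr F; apply: runinj.
Qed.

(** A letter appended to [tau] is prepended to its reversal, and it changes both lists in the same
    way at their front only. *)
Lemma chains_lengths (tau : seq nat) :
  [seq (ij.2 - ij.1).+1 | ij <- chains (fun p => entry tau p.+1 < entry tau p) (size tau)] =
    runlens ltn (rev tau).
Proof.
elim/last_ind: tau => [//|s x IH].
rewrite rev_rcons size_rcons [chains _ _]/=.
have Es k : k <= size s -> chains (fun p => entry (rcons s x) p.+1 < entry (rcons s x) p) k =
    chains (fun p => entry s p.+1 < entry s p) k.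
  elim: k => //= k IHk ks; rewrite IHk; last exact: ltnW.
  by rewrite /entry /= !nth_rcons ks (leq_ltn_trans (leq_pred k) ks).
rewrite Es // {Es}.
case/lastP: s IH => [|s y] IH; first by [].
set t := rcons s y in IH *.
have Ed : entry (rcons t x) (size t).+1 < entry (rcons t x) (size t) = (x < y).
  by rewrite /entry /= !nth_rcons ltnn eqxx /t size_rcons /= ltnSn ?nth_rcons ?ltnn ?eqxx.
rewrite Ed (_ : 0 < size t); last by rewrite size_rcons.
rewrite /t rev_rcons runlens_cons2 -rev_rcons -/t -IH /=.
have [H1 _ H3 _] := chainsP (fun p => entry t p.+1 < entry t p) (size t).
have [i [q E]] := H1 ltac:(by rewrite size_rcons).
case: ifP => _; last by rewrite /= subnn.
rewrite E /=; have [/= ? _ _ _ _] := H3 (i, size t) ltac:(by rewrite E mem_head).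
by congr (_ :: _); lia.
Qed.

Lemma size_inv_descent_runs n w : is_perm n w -> free231 w ->
  [seq size D | D <- inv_descent_runs w] = runlens ltn (rev (inverse w)).
Proof.
move=> Pw Fw; rewrite (inv_descent_runsE Pw Fw) -map_comp -chains_lengths.
rewrite size_inverse (perm_size1 Pw); apply: eq_map => ij /=.
by rewrite size_map size_iota.
Qed.


(** * Descent bottoms *)

Definition dbot (s : seq nat) : seq nat := [seq entry s i.+1 | i <- steps gtn s].

Lemma dbot_cons x y s :
  dbot [:: x, y & s] = (if y < x then [:: y] else [::]) ++ dbot (y :: s).
Proof.
rewrite /dbot steps_cons map_cat -map_comp; congr (_ ++ _); by rewrite /=; case: ifP.
Qed.

Lemma dbot_dsum n v w : is_perm (size v) v -> is_perm n w -> v != [::] ->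
  dbot (dsum v w) = dbot v ++ [seq x + size v | x <- dbot w].
Proof.
move=> Pv Pw v0; rewrite /dbot (steps_gtn_dsum Pv Pw v0) map_cat -!map_comp; congr (_ ++ _).
  apply/eq_in_map => i; rewrite mem_steps => /and3P[_ iv _].
  by rewrite /entry /dsum nth_cat /= iv.
apply/eq_in_map => i; rewrite mem_steps => /and3P[i0 iw _] /=.
rewrite /entry /dsum nth_cat /= ltnNge leq_addr /= addKn (nth_map 0) //.
Qed.

Lemma dbot_linked M x s : sorted (linked M) (x :: s) -> uniq (x :: s) ->
  dbot (x :: s) = [seq v <- s | v \notin M].
Proof.
elim: s x => [//|y s IH] x /= /andP[xy S] /andP[xs U].
rewrite dbot_cons IH //; move: xy xs; rewrite /linked inE negb_or => /eqP <- /andP[xy _].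
have -> : (y < x) = ~~ (x < y) by lia.
by case: (x < y).
Qed.

(** Membership of [y] in [M] is visible in the step leading to [y]; the first letter has no such
    step. *)
Lemma linked_eq M M' x s y : sorted (linked M) (x :: s) -> sorted (linked M') (x :: s) ->
  y \in s -> (y \in M) = (y \in M').
Proof.
elim: s x => [//|z s IH] x /= /andP[/eqP xz S] /andP[/eqP xz' S'].
by rewrite inE => /orP[/eqP->|]; [rewrite -xz -xz' | apply: IH S S'].
Qed.

Lemma steps_gtnE (s : seq nat) : uniq s ->
  steps gtn s = [seq i <- iota 1 (size s).-1 | i \notin steps ltn s].
Proof.
move=> Us; apply: eq_in_filter => i ii; rewrite mem_filter ii andbT.
move: ii; rewrite mem_iota => ii.
have h1 : i.-1 < size s by lia.
have h2 : i < size s by lia.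
have : entry s i != entry s i.+1 by rewrite /entry (nth_uniq 0 h1 h2 Us); lia.
rewrite /=; lia.
Qed.

(** * The map theta' on a block *)

Definition block (t : tree) : seq nat := (tsize t).+1 :: word t.

Lemma blockE t : block t = word (Bin t Leaf).
Proof. by rewrite word_Bin_Leaf. Qed.

Lemma size_block t : size (block t) = (tsize t).+1.
Proof. by rewrite /= size_word. Qed.

Lemma block_perm t : is_perm (tsize t).+1 (block t).
Proof. exact: is_perm_max (word_perm t). Qed.

Lemma word_free231 t : free231 (word t).
Proof.
elim: t => [|l IHl r IHr]; first by move=> a b c.
apply: (free231_dsum (word_block_perm l) (word_perm r)) => //.
exact: free231_max (word_perm l) IHl.
Qed.

Lemma theta'_block t : theta' (block t) = stack_procedure (cs (Bin t Leaf)) (steps ltn (block t)).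
Proof.
rewrite /theta' ascentsE (size_inv_descent_runs (block_perm t)).
  by rewrite /cs -blockE.
by rewrite blockE; apply: word_free231.
Qed.

Lemma count_mem_iota (M : seq nat) q s : uniq M -> all (fun a => a <= q + s) M ->
  count (mem M) (iota q.+1 s) = count (fun a => q < a) M.
Proof.
move=> UM aM; rewrite -!size_filter; apply/perm_size/uniq_perm.
- by rewrite filter_uniq // iota_uniq.
- by rewrite filter_uniq.
move=> x; rewrite !mem_filter mem_iota /=; case xM : (x \in M); rewrite ?andbF //=.
by have := allP aM x xM; lia.
Qed.

Lemma theta'_linked t :
  [/\ is_perm (tsize t).+1 (theta' (block t)), free231 (theta' (block t))
    & sorted (linked (steps ltn (block t))) (theta' (block t))].
Proof.
have c0 : cs (Bin t Leaf) != [::] by rewrite cs_nil -blockE.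
have Es : sumn (cs (Bin t Leaf)) = (tsize t).+1 by rewrite sumn_cs /= addn0.
have UM := steps_uniq ltn (block t).
have aM : all (fun a => a <= (tsize t).+1) (steps ltn (block t)).
  by apply/allP => a; rewrite mem_steps size_block => /and3P[_ /ltnW].
rewrite theta'_block -Es; apply: stack_procedureP => //.
- exact: runlens_pos.
(* The first run of the block is one longer than that of [t], and the ascents move up by one: the
   two shifts turn [cs_dyck] into the required bound. *)
- rewrite Es => i; have Ec : cs (Bin t Leaf) = inc (cs t) by rewrite cs_Bin /cs.
  rewrite Ec; have [El|l0] := eqVneq (word t) [::]; first by rewrite /cs El /=; lia.
  rewrite size_inc ?cs_nil // => ik; have := cs_dyck ik.
  have Et : sumn (take i (inc (cs t))) = (sumn (take i (cs t))).+1.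
    by case/andP: ik; case: i => // i; case: (cs t).
  rewrite Et; set s := sumn (take i (cs t)) => H.
  have st : s <= tsize t.
    by rewrite -sumn_cs -[X in _ <= sumn X](cat_take_drop i (cs t)) sumn_cat leq_addr.
  rewrite count_mem_iota //; last by rewrite subnK.
  apply: leq_trans H _; rewrite /block (steps_ltn_max (word_perm t)) count_map.
  by apply: sub_count => a /=; lia.
rewrite Es count_mem_iota // (_ : count _ _ = size (steps ltn (block t))).
  by rewrite size_cs_asc -?blockE.
by apply/eqP; rewrite -all_count; apply/allP => a; rewrite mem_steps => /andP[].
Qed.

Lemma theta'_perm t : is_perm (tsize t).+1 (theta' (block t)).
Proof. by have [] := theta'_linked t. Qed.

Lemma size_theta' t : size (theta' (block t)) = (tsize t).+1.
Proof. exact: perm_size1 (theta'_perm t). Qed.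

(* If [n] had a predecessor [a < n] in the output, [n] would be an ascent position. *)
Lemma theta'_head t : exists s, theta' (block t) = (tsize t).+1 :: s.
Proof.
have [P _ S] := theta'_linked t; have Ss := size_theta' t.
case: theta' P S Ss => [//|x s] P S _; exists s; congr (_ :: _).
have nM : (tsize t).+1 \notin steps ltn (block t).
  by rewrite mem_steps size_block ltnn andbF.
have : (tsize t).+1 \in x :: s by rewrite (perm_mem1 _ P) ltnSn.
rewrite inE => /orP[/eqP<-//|ns].
have le y : y \in x :: s -> y <= (tsize t).+1 by rewrite (perm_mem1 _ P) => /andP[].
have U := perm_uniq1 P.
elim: s x S ns le U {P} => [//|z s IH] x /= /andP[/eqP xz S] + le /andP[xs U].
rewrite inE => /orP[/eqP E|ns].
  move: xz; rewrite -E (negPf nM) => /negbT; rewrite -leqNgt => nx.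
  by apply/eqP; rewrite eqn_leq nx le // mem_head.
have Ez : z = (tsize t).+1 by apply: IH => // y ys; apply: le; rewrite inE ys orbT.
by move: U; rewrite Ez /= ns.
Qed.

Lemma last_shift m w y : w != [::] -> last y [seq z + m | z <- w] = last 0 w + m.
Proof. by case: w => //= z s _; apply: (last_map (addn^~ m)). Qed.

(** The last letter and c_1, which is [head 0 (cs t)], both come from the last summand. For a block
    this identifies the last letter with the first letter popped. *)
Lemma last_word t x : word t != [::] -> last x (word t) + head 0 (cs t) = (tsize t).+1.
Proof.
elim: t x => [//|l IHl r IHr] x _; rewrite cs_Bin word_Bin /dsum last_cat /= size_word.
have [Er|r0] := eqVneq (word r) [::].
  have [Er' Er0] : cs r = [::] /\ tsize r = 0 by rewrite -size_word /cs Er.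
  rewrite Er Er' Er0 /= addn0.
  have [El|l0] := eqVneq (word l) [::].
    have [-> ->] : cs l = [::] /\ tsize l = 0 by rewrite -size_word /cs El.
    by rewrite El.
  have := IHl (tsize l).+1 l0; have := cs_nil l; rewrite (negPf l0).
  by case: (cs l) => //= y s _ E; rewrite addnS E.
have -> : head 0 (cs r ++ inc (cs l)) = head 0 (cs r).
  by have := cs_nil r; rewrite (negPf r0); case: (cs r).
by rewrite last_shift // addnAC IHr // addnC addnS.
Qed.

Lemma last_theta' t : last 0 (theta' (block t)) = last 0 (block t).
Proof.
have := @last_word (Bin t Leaf) 0; rewrite -blockE => /(_ isT).
rewrite theta'_block /stack_procedure sumn_cs.
have := runlens_pos ltn (rev (inverse (word (Bin t Leaf)))); rewrite -/(cs _).
have : sumn (cs (Bin t Leaf)) = tsize (Bin t Leaf) by apply: sumn_cs.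
have : cs (Bin t Leaf) != [::] by rewrite cs_nil -blockE.
case: (cs _) => [//|c s] _ /= Es /andP[c0 _] Ec.
have [|X /= ->] := @stack_loop_first c s (steps ltn (block t)) [::] [::] ((tsize t).+1 + 0).
  by lia.
by rewrite last_cat /=; lia.
Qed.

Lemma dbot_theta' t : perm_eq (dbot (theta' (block t))) (steps gtn (block t)).
Proof.
have [P _ S] := theta'_linked t; have [s Es] := theta'_head t.
rewrite Es in P S *; rewrite (dbot_linked S (perm_uniq1 P)).
rewrite (steps_gtnE (perm_uniq1 (block_perm t))) size_block; apply: perm_filter.
by rewrite -/(is_perm _ _) -is_perm_maxE.
Qed.

Lemma theta'_inj t t' : theta' (block t) = theta' (block t') -> t = t'.
Proof.
move=> E; have [P _ S] := theta'_linked t; have [P' _ S'] := theta'_linked t'.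
have Et : tsize t = tsize t' by move: (size_theta' t'); rewrite -E size_theta' => -[].
have [s Es] := theta'_head t.
(* The first letter, about which [linked_eq] says nothing, is the length of the block and never an
   ascent position. *)
have EM : steps ltn (block t) = steps ltn (block t').
  rewrite E in Es; rewrite E Es in S; rewrite Es in S'.
  have sub u : steps ltn (block u) = [seq i <- iota 1 (tsize u) | i \in steps ltn (block u)].
    rewrite {1}/steps size_block; apply: eq_in_filter => i ii.
    by rewrite mem_filter size_block ii andbT.
  rewrite [LHS]sub [RHS]sub -Et; apply: eq_in_filter => i ii; apply: linked_eq S S' _.
  have : i \in theta' (block t') by rewrite (perm_mem1 _ P'); move: ii; rewrite mem_iota; lia.
  rewrite Es inE => /orP[/eqP Ei|//]; move: ii; rewrite mem_iota Ei; lia.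
have Ec : cs (Bin t Leaf) = cs (Bin t' Leaf).
  move: E; rewrite !theta'_block -EM /stack_procedure !sumn_cs /= -Et.
  by apply: stack_loop_inj; rewrite ?runlens_pos // ?sumn_cs /= ?Et.
by have [] : Bin t Leaf = Bin t' Leaf by apply: cs_asc_inj; rewrite // -!blockE.
Qed.

(** * The map theta *)

(** Uniqueness in [blocksP] identifies the blocks of [word (Bin l r)]. *)
Lemma theta_Bin l r : theta (word (Bin l r)) = dsum (theta' (block l)) (theta (word r)).
Proof.
have A t : Sn_av (tsize t) [:: 2; 3; 1] (word t).
  by split; [exact: word_perm | apply/avoids231P; exact: word_free231].
rewrite /theta -((blocksP (block l :: blocks (word r)) (A (Bin l r))).1 _) //.
have [E H] := (blocksP (blocks (word r)) (A r)).2 erefl.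
split; first by rewrite /= -/(dsums _) E.
move=> b; rewrite inE => /orP[/eqP->|]; last exact: H.
split=> //; split; last by rewrite size_block.
rewrite size_block; have := A (Bin l Leaf); by rewrite /= addn0 -/(word (Bin l Leaf)) -blockE.
Qed.

Lemma theta_word t : [/\ is_perm (tsize t) (theta (word t)), free231 (theta (word t)),
  last 0 (theta (word t)) = last 0 (word t)
  & perm_eq (dbot (theta (word t))) (steps gtn (word t))].
Proof.
elim: t => [|l _ r [P F L D]]; first by split.
have [Pl Fl _] := theta'_linked l; have Sl := size_theta' l.
have Pl' : is_perm (size (theta' (block l))) (theta' (block l)) by rewrite Sl.
have n0 : theta' (block l) != [::] by rewrite -size_eq0 Sl.
rewrite theta_Bin; split.
- exact: is_perm_dsum.
- exact: (free231_dsum Pl' P).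
- rewrite word_Bin /dsum !last_cat -/(block l) last_theta' Sl /= size_word.
  have [Er|r0] := eqVneq (word r) [::].
    by rewrite Er; move: (perm_size1 P); rewrite -size_word Er => /size0nil ->.
  rewrite !last_shift ?L //.
  by rewrite -size_eq0 (perm_size1 P) -size_word size_eq0.
- rewrite (dbot_dsum Pl' P n0) Sl word_Bin (steps_gtn_dsum (word_block_perm l) (word_perm r)) //.
  apply: perm_cat; first exact: dbot_theta'.
  rewrite -/(block l) size_block (eq_map (addnC (tsize l).+1)).
  exact: perm_map.
Qed.

Lemma theta_inj t t' : theta (word t) = theta (word t') -> t = t'.
Proof.
elim: t t' => [|l _ r IH] [|l' r'] // E.
- by have [/perm_size1 + _ _ _] := theta_word (Bin l' r'); rewrite -E.
- by have [/perm_size1 + _ _ _] := theta_word (Bin l r); rewrite E.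
move: E; rewrite !theta_Bin => E.
have Sl := size_theta' l; have Sl' := size_theta' l'.
(* The image of a block starts with the length of the block, which locates the junction of the
   direct sum. *)
have Et : tsize l = tsize l'.
  move: E; have [s ->] := theta'_head l; have [s' ->] := theta'_head l'.
  by rewrite /dsum /= => -[].
have /eqP := E; rewrite /dsum eqseq_cat ?Sl ?Sl' ?Et // => /andP[/eqP/theta'_inj-> /eqP].
by move=> /(inj_map (@addIn _)) /IH->.
Qed.


(** * Pattern counts as sums over descents *)

Lemma count_sum (a : pred nat) s : count a s = \sum_(x <- s) a x.
Proof. by rewrite -sum1_count big_mkcond; apply: eq_bigr => x _; case: (a x). Qed.

Lemma count_pairsE w P : count_pairs w P =
  \sum_(i <- iota 1 (size w)) count (P i) (iota 1 (size w)).
Proof.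
rewrite /count_pairs -sum1_count big_mkcond big_allpairs; apply: eq_bigr => i _.
by rewrite -sum1_count [RHS]big_mkcond.
Qed.

Lemma exchange_count (R : nat -> pred nat) s t :
  \sum_(i <- s) count (R i) t = \sum_(j <- t) count (R^~ j) s.
Proof.
under eq_bigr do rewrite count_sum.
by rewrite exchange_big; apply: eq_bigr => j _; rewrite count_sum.
Qed.

Lemma count_split (a b c : pred nat) s :
  (forall x, x \in s -> a x + b x = c x :> nat) -> count a s + count b s = count c s.
Proof.
move=> H; rewrite !count_sum -big_split; apply: eq_big_seq => x /H; exact.
Qed.

Lemma count_gt_iota k n : count (fun j => k < j) (iota 1 n) = n - k.
Proof.
elim: n => [//|n IH]; rewrite iota1S count_cat IH /=; lia.
Qed.

Lemma map_entry w : [seq entry w j | j <- iota 1 (size w)] = w.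
Proof.
rewrite (iotaDl 1 0) -map_comp -[RHS](mkseq_nth 0).
by apply: eq_map => i.
Qed.

Lemma count_entry_gt n w v : is_perm n w ->
  count (fun j => v < entry w j) (iota 1 (size w)) = n - v.
Proof.
move=> Pw; rewrite -(count_map (entry w) (fun x => v < x)) map_entry.
by rewrite (permP Pw) count_gt_iota.
Qed.

Lemma sum_steps (e : rel nat) w (F : nat -> nat) :
  \sum_(i <- iota 1 (size w)) (if (i < size w) && e (entry w i) (entry w i.+1) then F i else 0)
    = \sum_(i <- steps e w) F i.
Proof.
rewrite /steps big_filter [RHS]big_mkcond; case: w => [|x w]; first by rewrite !big_nil.
have -> : iota 1 (size (x :: w)) = iota 1 (size w) ++ [:: (size w).+1].
  exact: iota1S.
rewrite big_cat big_seq1 ltnn /= addn0; apply: eq_big_seq => i; rewrite mem_iota => /andP[_ iw].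
by rewrite ltnS -ltnS -add1n iw.
Qed.

Lemma perm_neq (w : seq nat) i j : uniq w -> 0 < i < j -> j <= size w -> entry w i != entry w j.
Proof.
move=> U ij jn; have h1 : i.-1 < size w by lia.
have h2 : j.-1 < size w by lia.
by rewrite /entry (nth_uniq 0 h1 h2 U); lia.
Qed.

Lemma free312_entry w i j k : free312 w -> 0 < i -> i < j -> j < k -> k <= size w ->
  ~~ ((entry w j < entry w k) && (entry w k < entry w i)).
Proof. by move=> F i0 ij jk kn; apply: F; apply: subseq_nth3; lia. Qed.

Lemma u21_3_u32_1_free312 w : uniq w -> free312 w ->
  pat_u21_3 w + pat_u32_1 w = \sum_(i <- steps gtn w) (size w - i.+1).
Proof.
move=> U F; rewrite -(sum_steps gtn w (fun i => size w - i.+1)).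
rewrite /pat_u21_3 /pat_u32_1 !count_pairsE -big_split; apply: eq_big_seq => i.
rewrite mem_iota => ii; rewrite -count_gt_iota.
case: ifP => [/andP[iw /= di]|di].
  apply: count_split => j; rewrite mem_iota => jj /=.
  case: (ltnP i.+1 j) => //= ij; rewrite di andbT /=.
  have := free312_entry F (i := i) (j := i.+1) (k := j) ltac:(lia) ltac:(lia) ij ltac:(lia).
  have := perm_neq (i := i) (j := j) U ltac:(lia) ltac:(lia).
  have := perm_neq (i := i.+1) (j := j) U ltac:(lia) ltac:(lia).
  lia.
rewrite -[RHS](count_pred0 (iota 1 (size w))); apply: count_split => j; rewrite mem_iota => jj /=.
case: (ltnP i.+1 j) => //= ij; move: di; rewrite (_ : i < size w) /=; last by lia.
by move=> ->; rewrite andbF.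
Qed.

Lemma u21_3_3_u21_perm n w : is_perm n w ->
  pat_u21_3 w + pat_3_u21 w = \sum_(i <- steps gtn w) (n - entry w i).
Proof.
move=> Pw; have U := perm_uniq1 Pw; rewrite -(sum_steps gtn w (fun i => n - entry w i)).
(* In [pat_3_u21] the descent is the second index, so the summations are exchanged to group the
   pairs by descent. *)
rewrite /pat_u21_3 /pat_3_u21 !count_pairsE [X in _ + X]exchange_count -big_split.
apply: eq_big_seq => i; rewrite mem_iota => ii; rewrite -(count_entry_gt _ Pw).
case: ifP => [/andP[iw /= di]|di].
  apply: count_split => j; rewrite mem_iota => jj /=; rewrite iw di /=.
  have [->|[->|ij]] : j = i \/ j = i.+1 \/ (j < i) || (i.+1 < j) by lia.
  - by rewrite !ltnn !andbF.
  - by rewrite ltnn [i.+1 < i]ltnNge leqnSn /= ltnNge (ltnW di).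
  - case/orP: ij => ij; rewrite ij /=.
      by rewrite [i.+1 < j]ltnNge (ltnW (leqW ij)).
    by rewrite [j < i]ltnNge (ltnW (ltnW ij)) addn0.
rewrite -[RHS](count_pred0 (iota 1 (size w))); apply: count_split => j; rewrite mem_iota => jj /=.
case: (ltnP i (size w)) di => [iw /= ->|wi _]; first by rewrite !andbF.
by rewrite !andbF addn0 [i.+1 < j]ltnNge (_ : j <= i.+1) //; lia.
Qed.

(** Without downward crossings, the level [v] is crossed upwards once if the path starts below [v]
    and ends at or above it, and never otherwise. *)
Lemma crossings (w : nat -> nat) v k :
  (forall i, 0 < i <= k -> v <= w i -> v <= w i.+1) ->
  count (fun i => w i < v <= w i.+1) (iota 1 k) + (w k.+1 < v) = (w 1 < v).
Proof.
elim: k => [//|k IH] H; rewrite iota1S count_cat /=.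
rewrite -IH => [|i ik]; last by apply: H; lia.
rewrite -addnA; congr (_ + _); rewrite addn0; have := H k.+1; rewrite ltnSn => /(_ isT).
by case: (ltnP (w k.+1) v); case: (ltnP (w k.+2) v) => // _ _ /(_ isT).
Qed.

(* Together, the two counts number the pairs [i < j] with [w_i < w_j <= w_(i+1)], that is, the upward
   crossings of the level [w_j] before position [j]; a downward crossing there would be a 312. *)
Lemma u13_2_free312 n w : is_perm n w -> free312 w ->
  pat_u13_2 w + size (steps ltn w) = n - entry w 1.
Proof.
move=> Pw F; have U := perm_uniq1 Pw; have Sw := perm_size1 Pw.
have -> : size (steps ltn w) = \sum_(i <- iota 1 (size w))
    count (fun j => (j == i.+1) && (entry w i < entry w i.+1)) (iota 1 (size w)).
  rewrite -sum1_size -(sum_steps ltn w (fun=> 1)); apply: eq_big_seq => i; rewrite mem_iota => ii.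
  case: ifP => /= [/andP[iw ->]|di].
    under eq_count do rewrite andbT.
    by rewrite count_uniq_mem ?iota_uniq // mem_iota; lia.
  rewrite -[LHS](count_pred0 (iota 1 (size w))); apply: eq_in_count => j; rewrite mem_iota /=; lia.
rewrite /pat_u13_2 count_pairsE -big_split.
(* The ascents supply the case [j = i.+1], where the upper bound is an equality; for all other [j]
   it is strict because letters are distinct. *)
rewrite (eq_big_seq (fun i => count (fun j => (i < j) && (entry w i < entry w j <= entry w i.+1))
    (iota 1 (size w)))); last first.
  move=> i; rewrite mem_iota => ii; apply: count_split => j; rewrite mem_iota => jj /=.
  have [->|ij] := eqVneq j i.+1; first by rewrite ltnn ltnSn leqnn andbT.
  rewrite addn0; case: (ltnP i.+1 j) => ij'; last by rewrite [i < j]ltnNge (_ : j <= i) //; lia.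
  rewrite (ltnW ij') [entry w j <= _]leq_eqVlt eq_sym (negPf (perm_neq _ _ _)) //; lia.
rewrite exchange_count -(count_entry_gt _ Pw) count_sum; apply: eq_big_seq => j.
rewrite mem_iota => jj.
have -> : iota 1 (size w) = iota 1 j.-1 ++ iota (1 + j.-1) (size w - j.-1).
  by rewrite -iotaD subnKC //; lia.
rewrite count_cat [X in _ + X](_ : _ = 0); last first.
  by apply/eqP; rewrite -leqn0 leqNgt -has_count; apply/hasPn => i; rewrite mem_iota; lia.
rewrite addn0 -(@crossings (entry w) (entry w j) j.-1) => [|i ij].
  (* The path ends at position [j], exactly on the level, so the end term vanishes. *)
  rewrite prednK ?ltnn ?addn0; last by lia.
  by apply: eq_in_count => i; rewrite mem_iota; lia.
have [<-|ne] := eqVneq i.+1 j; first by [].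
have := free312_entry F (i := i) (j := i.+1) (k := j) ltac:(lia) ltac:(lia) ltac:(lia) ltac:(lia).
have := perm_neq (i := i) (j := j) U ltac:(lia) ltac:(lia).
lia.
Qed.

(** * Reverse complement *)

Definition rc (w : seq nat) : seq nat := complement (rev w).

Lemma size_rc w : size (rc w) = size w.
Proof. by rewrite size_map size_rev. Qed.

Lemma rcE w : rc w = [seq (size w).+1 - x | x <- rev w].
Proof. by rewrite /rc /complement size_rev. Qed.

Lemma rc_perm n w : is_perm n w -> is_perm n (rc w).
Proof.
move=> Pw; apply: uniq_perm; rewrite ?iota_uniq // rcE (perm_size1 Pw).
  rewrite map_inj_in_uniq ?rev_uniq ?(perm_uniq1 Pw) // => x y.
  by rewrite !mem_rev !(perm_mem1 _ Pw); lia.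
move=> x; rewrite mem_iota; apply/mapP/idP => [[y]|xn].
  by rewrite mem_rev (perm_mem1 _ Pw) => ? ->; lia.
by exists (n.+1 - x); rewrite ?mem_rev ?(perm_mem1 _ Pw); lia.
Qed.

Lemma rcK n w : is_perm n w -> rc (rc w) = w.
Proof.
move=> Pw; rewrite rcE size_rc rcE -map_rev revK -map_comp -[RHS]map_id.
apply/eq_in_map => x; rewrite (perm_mem1 _ Pw) (perm_size1 Pw) /=; lia.
Qed.

Lemma entry_rc w i : 0 < i <= size w -> entry (rc w) i = (size w).+1 - entry w ((size w).+1 - i).
Proof.
move=> ii; rewrite rcE /entry (nth_map 0) ?size_rev ?nth_rev; try lia.
by congr (_ - nth _ _ _); lia.
Qed.

Lemma subseq_rc n w (a b c : nat) : is_perm n w -> subseq [:: a; b; c] (rc w) ->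
  subseq [:: n.+1 - c; n.+1 - b; n.+1 - a] w /\ [&& a <= n, b <= n & c <= n].
Proof.
move=> Pw S; split.
  have := map_subseq (fun x => n.+1 - x) S.
  rewrite -subseq_rev -map_rev -{2}(rcK Pw) [rc (rc w)]rcE size_rc (perm_size1 Pw) -map_rev.
  by rewrite /rev /=.
have H x : x \in [:: a; b; c] -> x <= n.
  by move=> /(mem_subseq S); rewrite (perm_mem1 _ (rc_perm Pw)) => /andP[].
by rewrite !H // !inE eqxx ?orbT.
Qed.

Lemma rc_free231 n w : is_perm n w -> free312 w -> free231 (rc w).
Proof. by move=> Pw F a b c /(subseq_rc Pw)[/F]; lia. Qed.

Lemma rc_free312 n w : is_perm n w -> free231 w -> free312 (rc w).
Proof. by move=> Pw F a b c /(subseq_rc Pw)[/F]; lia. Qed.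

(** Reversal moves step [i] to [n - i] and exchanges ascents and descents; the complement exchanges
    them back. *)
Lemma steps_gtn_rc n w : is_perm n w ->
  perm_eq (steps gtn (rc w)) [seq n - i | i <- steps gtn w].
Proof.
move=> Pw; have Sw := perm_size1 Pw; have U := perm_uniq1 Pw; apply: uniq_perm.
- exact: steps_uniq.
- rewrite map_inj_in_uniq ?steps_uniq // => i j; rewrite !mem_steps Sw; lia.
have le i : 0 < i <= n -> entry w i <= n.
  move=> ii; have : entry w i \in w by apply: mem_nth; rewrite Sw; lia.
  by rewrite (perm_mem1 _ Pw) => /andP[].
have R i : 0 < i < n -> gtn (entry (rc w) i) (entry (rc w) i.+1) =
    gtn (entry w (n - i)) (entry w (n - i).+1).
  move=> ii; rewrite !entry_rc ?Sw; try lia.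
  rewrite !subSS (@subSn i n); last by lia.
  have [i1 i2] : 0 < n - i <= n /\ 0 < (n - i).+1 <= n by lia.
  by move: (le _ i1) (le _ i2); rewrite /=; lia.
move=> i; rewrite mem_steps size_rc Sw; apply/idP/mapP.
  move=> /and3P[i0 iN H]; exists (n - i); last by lia.
  rewrite mem_steps Sw; apply/and3P; split; try lia.
  by rewrite /= -[_ < _]R //; lia.
move=> [j]; rewrite mem_steps Sw => /and3P[j0 jn H] ->.
apply/and3P; split; try lia.
have := R (n - j); rewrite subKn ?(ltnW jn) // => E.
by apply: etrans (E _) H; lia.
Qed.

(** * The bijection *)

Lemma theta_surj n w : is_perm n w -> free231 w ->
  exists v, [/\ is_perm n v, free231 v & theta v = w].
Proof.
move=> Pw Fw; pose X := [seq v <- permutations (iota 1 n) | `[< free231 v >]].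
have XE v : (v \in X) = `[< is_perm n v /\ free231 v >].
  rewrite mem_filter mem_permutations; apply/andP/asboolP => [[/asboolP ? ?]|[? ?]] //.
  by split=> //; apply/asboolP.
have UX : uniq X by rewrite filter_uniq // permutations_uniq.
have UT : uniq (map theta X).
  rewrite map_inj_in_uniq // => u v; rewrite !XE => /asboolP[Pu Fu] /asboolP[Pv Fv].
  have [t ->] := word_surj Pu Fu; have [t' ->] := word_surj Pv Fv.
  by move=> /theta_inj ->.
have sub : {subset map theta X <= X}.
  move=> _ /mapP [u + ->]; rewrite !XE => /asboolP[Pu Fu]; apply/asboolP.
  have [t Et] := word_surj Pu Fu; have [P F _ _] := theta_word t.
  by rewrite Et -(perm_size1 Pu) Et size_word.
(* A duplicate-free list contained in [X] and of the same size has the same elements. *)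
have [_ E] := uniq_min_size UT sub ltac:(by rewrite size_map).
have : w \in map theta X by rewrite E XE; apply/asboolP.
move=> /mapP [v + ->]; rewrite XE => /asboolP[Pv Fv].
by exists v.
Qed.

Lemma theta_av n w : is_perm n w -> free231 w -> is_perm n (theta w) /\ free231 (theta w).
Proof.
move=> Pw Fw; have [t E] := word_surj Pw Fw; have [P F _ _] := theta_word t.
by rewrite -(perm_size1 Pw) E size_word.
Qed.

(** * The two statistics of a 312-avoider *)

Lemma desE w : des w = size (steps gtn w).
Proof. by rewrite /des /steps size_filter. Qed.

(** Adding [n.-1], the number of ascents and descents together, avoids subtraction: it cancels the
    ascents subtracted in the 13-2 count and leaves a second [des w]. *)
Lemma bastE n w : 0 < n -> is_perm n w -> free312 w ->
  bast w + n.-1 = n - entry w 1 + \sum_(i <- steps gtn w) (n - i.+1) + (des w).*2.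
Proof.
move=> n0 Pw F; have U := perm_uniq1 Pw; have Sw := perm_size1 Pw.
have := size_steps_ltn_gtn U; have := u13_2_free312 Pw F; have := u21_3_u32_1_free312 U F.
by rewrite /bast desE Sw; lia.
Qed.

Lemma fozeE n w : 0 < n -> is_perm n w -> free312 w ->
  foze w + n.-1 = n - entry w 1 + \sum_(i <- steps gtn w) (n - entry w i) + (des w).*2.
Proof.
move=> n0 Pw F; have U := perm_uniq1 Pw; have Sw := perm_size1 Pw.
have := size_steps_ltn_gtn U; have := u13_2_free312 Pw F; have := u21_3_3_u21_perm Pw.
by rewrite /foze desE Sw; lia.
Qed.

Lemma entry_rc_last n w : 0 < n -> is_perm n w -> entry (rc w) 1 = n.+1 - last 0 w.
Proof.
move=> n0 Pw; have Sw := perm_size1 Pw; rewrite entry_rc ?Sw ?n0 //.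
by rewrite subSS subn0 /entry -nth_last Sw.
Qed.

Lemma bast_foze n w : 0 < n -> is_perm n w -> free312 w -> bast w = foze (Theta w).
Proof.
move=> n0 Pw Fw; have Ps := rc_perm Pw; have Fs := rc_free231 Pw Fw.
have [Pt Ft] := theta_av Ps Fs; have Pr := rc_perm Pt; have Fr := rc_free312 Pt Ft.
rewrite -[Theta w]/(rc (theta (rc w))).
set sg := rc w in Ps Fs Pt Ft Pr Fr *; set ta := theta sg in Pt Ft Pr Fr *.
have [L D] : last 0 ta = last 0 sg /\ perm_eq (dbot ta) (steps gtn sg).
  by rewrite /ta; have [t ->] := word_surj Ps Fs; have [_ _ ? ?] := theta_word t.
have Ew : w = rc sg by rewrite /sg (rcK Pw).
have E1 : entry w 1 = entry (rc ta) 1 by rewrite Ew !(@entry_rc_last n) // L.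
have E2 : des w = des (rc ta).
  rewrite !desE Ew (perm_size (steps_gtn_rc Ps)) (perm_size (steps_gtn_rc Pt)).
  by rewrite !size_map -(perm_size D) size_map.
(* A descent [i] of [sg] is the descent [n - i] of [w], whose weight is [n - (n - i).+1 = i.-1]. *)
have E3 : \sum_(i <- steps gtn w) (n - i.+1) = \sum_(x <- dbot ta) x.-1.
  rewrite Ew (perm_big _ (steps_gtn_rc Ps)) (perm_big _ D) big_map.
  by apply: eq_big_seq => i; rewrite mem_steps (perm_size1 Ps); lia.
(* A descent [i] of [ta] is the descent [n - i] of [rc ta], where the letter is [n.+1] minus the
   descent bottom [entry ta i.+1]. *)
have E4 : \sum_(i <- steps gtn (rc ta)) (n - entry (rc ta) i) = \sum_(x <- dbot ta) x.-1.
  rewrite (perm_big _ (steps_gtn_rc Pt)) !big_map; apply: eq_big_seq => i.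
  have St := perm_size1 Pt.
  rewrite mem_steps St => /and3P[i0 iN _]; rewrite entry_rc St; last by lia.
  have -> : n.+1 - (n - i) = i.+1 by lia.
  have : entry ta i.+1 \in ta by apply: mem_nth; rewrite St.
  rewrite (perm_mem1 _ Pt); lia.
have := bastE n0 Pw Fw; have := fozeE n0 Pr Fr; rewrite -E1 -E2 E3 E4; lia.
Qed.

Theorem theorem3p16 (n : nat) (hn : 1 <= n) :
  set_bij (Sn_av n [:: 3; 1; 2]) (Sn_av n [:: 3; 1; 2]) Theta /\
  (forall pi : seq nat, Sn_av n [:: 3; 1; 2] pi -> bast pi = foze (Theta pi)).
Proof.
split; last by move=> w [Pw /avoids312P Fw]; apply: bast_foze hn Pw Fw.
have ThE w : Theta w = rc (theta (rc w)) by [].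
split.
- move=> w [Pw /avoids312P Fw].
  have [Pt Ft] := theta_av (rc_perm Pw) (rc_free231 Pw Fw).
  by split; [exact: rc_perm | apply/avoids312P; exact: rc_free312 Pt Ft].
- move=> u v /set_mem [Pu /avoids312P Fu] /set_mem [Pv /avoids312P Fv].
  have Pu' := rc_perm Pu; have Pv' := rc_perm Pv.
  have Fu' := rc_free231 Pu Fu; have Fv' := rc_free231 Pv Fv.
  rewrite !ThE => /(congr1 rc).
  rewrite (rcK (theta_av Pu' Fu').1) (rcK (theta_av Pv' Fv').1).
  have [t Et] := word_surj Pu' Fu'; have [t' Et'] := word_surj Pv' Fv'.
  by rewrite Et Et' => /theta_inj E; rewrite -(rcK Pu) Et E -Et' (rcK Pv).
move=> w [Pw /avoids312P Fw].
have [v [Pv Fv Ev]] := theta_surj (rc_perm Pw) (rc_free231 Pw Fw).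
exists (rc v); last by rewrite ThE (rcK Pv) Ev (rcK Pw).
by split; [exact: rc_perm | apply/avoids312P; exact: rc_free312 Pv Fv].
Qed.
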